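(* There is a natural isomorphism of categories from the category of Frölicher spaces (with Frölicher smooth maps) to the category of reflexive differential spaces (with functionally smooth maps), given by the forgetful functor $\mathbf{\Xi}$, $\mathbf{\Xi}(X,\mathcal{C},\mathcal{F})=(X,\mathcal{F})$, $\mathbf{\Xi}(F)=F$ on maps.
   Context: A parametrisation of a nonempty set $X$ is a function $p:U\to X$ with $U$ an open subset of some $\mathbb{R}^n$. A differential structure on a nonempty set $X$ is a nonempty family $\mathcal{F}$ of functions $X\to\mathbb{R}$, together with the weakest topology making every element of $\mathcal{F}$ continuous, such that: (1) for $f_1,\dots,f_k\in\mathcal{F}$ and $F\in C^\infty(\mathbb{R}^k)$, $F(f_1,\dots,f_k)\in\mathcal{F}$; (2) if $f:X\to\mathbb{R}$ is such that every $x\in X$ has an open neighbourhood $U$ and some $g\in\mathcal{F}$ with $f|_U=g|_U$, then $f\in\mathcal{F}$. $(X,\mathcal{F})$ is a differential space. A map $F:(X,\mathcal{F}_X)\to(Y,\mathcal{F}_Y)$ is functionally smooth if $f\circ F\in\mathcal{F}_X$ for all $f\in\mathcal{F}_Y$. For a set $\mathcal{D}_0$ of parametrisations into $X$ (in particular for a set of curves $\mathbb{R}\to X$) let $\Phi\mathcal{D}_0=\{f:X\to\mathbb{R}\mid f\circ p \text{ is smooth } \forall p\in\mathcal{D}_0\}$. For a set $\mathcal{F}_0$ of functions $X\to\mathbb{R}$ let $\Pi\mathcal{F}_0=\{\text{parametrisations }p \text{ of } X\mid f\circ p\text{ is smooth }\forall f\in\mathcal{F}_0\}$ and $\Gamma\mathcal{F}_0=\{c:\mathbb{R}\to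 X\mid f\circ c\in C^\infty(\mathbb{R})\ \forall f\in\mathcal{F}_0\}$. A differential structure $\mathcal{F}$ is reflexive if $\Phi\Pi\mathcal{F}=\mathcal{F}$; reflexive differential spaces form a full subcategory of differential spaces. A Frölicher space is a triple $(X,\mathcal{C},\mathcal{F})$ with $\mathcal{C}$ a family of curves $\mathbb{R}\to X$ and $\mathcal{F}$ a family of functions $X\to\mathbb{R}$ such that $\Phi\mathcal{C}=\mathcal{F}$ and $\Gamma\mathcal{F}=\mathcal{C}$. A map $F:(X,\mathcal{C}_X,\mathcal{F}_X)\to(Y,\mathcal{C}_Y,\mathcal{F}_Y)$ is Frölicher smooth if $f\circ F\in\mathcal{F}_X$ for every $f\in\mathcal{F}_Y$. *)

(* Defs.v *)
From HB Require Import structures.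
From mathcomp Require Import all_boot all_order all_algebra.
From mathcomp Require Import all_classical all_reals all_analysis.
Import Order.TTheory GRing.Theory Num.Theory.
Import numFieldNormedType.Exports.

Set Implicit Arguments.
Unset Strict Implicit.
Unset Printing Implicit Defensive.

Local Open Scope classical_set_scope.
Local Open Scope ring_scope.

#[local] Obligation Tactic := idtac.

Record category := Category {
  obj : Type;
  hom : obj -> obj -> Type;
  idm : forall a, hom a a;
  compm : forall a b c, hom b c -> hom a b -> hom a c;
  compmA : forall a b c d (h : hom c d) (g : hom b c) (f : hom a b),
    compm h (compm g f) = compm (compm h g) f;
  comp1m : forall a b (f : hom a b), compm (idm b) f = f;
  compm1 : forall a b (f : hom a b), compm f (idm a) = f }.

Arguments idm : clear implicits.
Arguments compm {c a b c0} : rename.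

Record functor (C D : category) := Functor {
  fobj : obj C -> obj D;
  fmap : forall a b, hom a b -> hom (fobj a) (fobj b);
  fmap1 : forall a, fmap (idm C a) = idm D (fobj a);
  fmapM : forall a b c (g : hom b c) (f : hom a b),
    fmap (compm g f) = compm (fmap g) (fmap f) }.

Definition id_functor (C : category) : functor C C :=
  @Functor C C id (fun _ _ f => f) (fun _ => erefl) (fun _ _ _ _ _ => erefl).

Program Definition comp_functor (C D E : category)
    (G : functor D E) (F : functor C D) : functor C E :=
  @Functor C E (fun a => fobj G (fobj F a))
    (fun a b f => fmap G (fmap F f)) _ _.
Next Obligation. by move=> C D E G F a /=; rewrite !fmap1. Qed.
Next Obligation. by move=> C D E G F a b c g f /=; rewrite !fmapM. Qed.

(* Strict isomorphism (not equivalence): the composites are equal to the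
   identity functors. *)
Definition is_category_iso (C D : category) (F : functor C D) : Prop :=
  exists G : functor D C,
    comp_functor G F = id_functor C /\ comp_functor F G = id_functor D.

Definition full_subcategory (C : category) (P : obj C -> Prop) : category :=
  @Category {a : obj C | P a} (fun a b => hom (sval a) (sval b))
    (fun a => idm C (sval a)) (fun _ _ _ g f => compm g f)
    (fun _ _ _ _ => @compmA C _ _ _ _) (fun _ _ => @comp1m C _ _)
    (fun _ _ => @compm1 C _ _).

Section Smoothness.
Variable R : realType.

Definition smooth_curve (g : R -> R) : Prop :=
  forall (n : nat) (x : R), derivable (g^`(n))%classic x 1.

(* All iterated partial derivatives of f of order at most r exist and are
   continuous on U (used for U open, so the values of f off U are
   irrelevant). *)
Fixpoint Cr_on (n r : nat) (U : set 'rV[R]_n) (f : 'rV[R]_n -> R) : Prop :=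
  (forall x, U x -> {for x, continuous f}) /\
  match r with
  | 0 => True
  | r'.+1 => forall i : 'I_n,
      (forall x, U x -> derivable f x (delta_mx 0 i)) /\
      Cr_on r' U ('D_(delta_mx 0 i) f)
  end.

Definition smooth_on (n : nat) (U : set 'rV[R]_n) (f : 'rV[R]_n -> R) : Prop :=
  forall r, Cr_on r U f.

(* Smoothness of a function h defined only on the open set U: g is an
   arbitrary extension, on which nothing is required outside U. *)
Definition smooth_from (n : nat) (U : set 'rV[R]_n) (h : set_type U -> R) :
    Prop :=
  exists g : 'rV[R]_n -> R, (forall u, g (\val u) = h u) /\ smooth_on U g.

End Smoothness.

Record parametrisation (R : realType) (X : Type) := Parametrisation {
  par_dim : nat;
  par_dom : set 'rV[R]_par_dim;
  par_open : open par_dom;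
  par_fun : set_type par_dom -> X }.

Arguments par_dom {R X} p.
Arguments par_fun {R X} p.

Section Spaces.
Variable R : realType.

Definition Phi (X : Type) (D : set (parametrisation R X)) : set (X -> R) :=
  [set f : X -> R | forall p, D p -> smooth_from (f \o par_fun p)].

Definition Phi_curves (X : Type) (C : set (R -> X)) : set (X -> R) :=
  [set f : X -> R | forall c, C c -> smooth_curve (f \o c)].

Definition Pi (X : Type) (F : set (X -> R)) : set (parametrisation R X) :=
  [set p : parametrisation R X |
    forall f : X -> R, F f -> smooth_from (f \o par_fun p)].

Definition Gamma (X : Type) (F : set (X -> R)) : set (R -> X) :=
  [set c : R -> X |
    forall f : X -> R, F f -> smooth_curve (f \o c)].

Definition is_topology (X : Type) (T : set (set X)) : Prop :=
  [/\ T setT, (forall A B, T A -> T B -> T (A `&` B)) &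
      (forall S : set (set X), S `<=` T -> T (\bigcup_(A in S) A))].

(* The open sets of the weakest topology making every element of F
   continuous. *)
Definition initial_open (X : Type) (F : set (X -> R)) : set (set X) :=
  smallest (@is_topology X)
    [set A | exists f V, [/\ F f, open V & A = f @^-1` V]].

Definition differential_structure (X : Type) (F : set (X -> R)) : Prop :=
  [/\ F !=set0,
      (forall (k : nat) (f : 'I_k -> X -> R) (G : 'rV[R]_k -> R),
         (0 < k)%N -> (forall i, F (f i)) -> smooth_on setT G ->
         F (fun x => G (\row_i f i x))) &
      (forall f : X -> R,
         (forall x, exists U g,
            [/\ initial_open F U, U x, F g & {in U, f =1 g}]) ->
         F f)].

Record differential_space := DifferentialSpace {
  ds_carrier : Type;
  ds_nonempty : inhabited ds_carrier;
  ds_fun : set (ds_carrier -> R);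
  ds_structure : differential_structure ds_fun }.

Definition functionally_smooth (X Y : differential_space)
    (h : ds_carrier X -> ds_carrier Y) : Prop :=
  forall f, ds_fun f -> ds_fun (f \o h).

Definition reflexive_structure (X : Type) (F : set (X -> R)) : Prop :=
  Phi (Pi F) = F.

(* Underlying sets are nonempty here too: otherwise the empty set would carry a
   Frolicher structure but no differential structure. *)
Record frolicher_space := FrolicherSpace {
  fs_carrier : Type;
  fs_nonempty : inhabited fs_carrier;
  fs_curve : set (R -> fs_carrier);
  fs_fun : set (fs_carrier -> R);
  fs_PhiE : Phi_curves fs_curve = fs_fun;
  fs_GammaE : Gamma fs_fun = fs_curve }.

Definition frolicher_smooth (X Y : frolicher_space)
    (h : fs_carrier X -> fs_carrier Y) : Prop :=
  forall f, fs_fun f -> fs_fun (f \o h).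

Program Definition DiffSp : category :=
  @Category differential_space
    (fun X Y => {h : ds_carrier X -> ds_carrier Y | functionally_smooth h})
    (fun X => exist _ id _)
    (fun X Y Z g h => exist _ (sval g \o sval h) _) _ _ _.
Next Obligation. by move=> X f. Qed.
Next Obligation. by move=> X Y Z [g gP] [h hP] f /gP/hP. Qed.
Next Obligation. by move=> a b c d h g f; apply: eq_exist. Qed.
Next Obligation. by move=> a b [f fP]; apply: eq_exist. Qed.
Next Obligation. by move=> a b [f fP]; apply: eq_exist. Qed.

Definition RefDiffSp : category :=
  @full_subcategory DiffSp
    (fun X : differential_space => reflexive_structure (@ds_fun X)).

Program Definition FrolSp : category :=
  @Category frolicher_space
    (fun X Y => {h : fs_carrier X -> fs_carrier Y | frolicher_smooth h})
    (fun X => exist _ id _)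
    (fun X Y Z g h => exist _ (sval g \o sval h) _) _ _ _.
Next Obligation. by move=> X f. Qed.
Next Obligation. by move=> X Y Z [g gP] [h hP] f /gP/hP. Qed.
Next Obligation. by move=> a b c d h g f; apply: eq_exist. Qed.
Next Obligation. by move=> a b [f fP]; apply: eq_exist. Qed.
Next Obligation. by move=> a b [f fP]; apply: eq_exist. Qed.

(* Objects of RefDiffSp carry proofs, so the object part (X, C, F) |-> (X, F)
   of Xi takes as argument the fact that its values are reflexive differential
   spaces. *)
Definition Xi_well_defined : Prop :=
  forall X : frolicher_space,
    differential_structure (@fs_fun X) /\ reflexive_structure (@fs_fun X).

Definition Xi_obj (wd : Xi_well_defined) (X : frolicher_space) : obj RefDiffSp :=
  exist _ (DifferentialSpace (fs_nonempty X) (proj1 (wd X))) (proj2 (wd X)).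

Definition Xi_map (wd : Xi_well_defined) (X Y : frolicher_space)
    (h : {h : fs_carrier X -> fs_carrier Y | frolicher_smooth h}) :
    @hom RefDiffSp (Xi_obj wd X) (Xi_obj wd Y) :=
  exist _ (sval h) (svalP h).

Program Definition Xi (wd : Xi_well_defined) : functor FrolSp RefDiffSp :=
  @Functor FrolSp RefDiffSp (Xi_obj wd) (@Xi_map wd) _ _.
Next Obligation. by move=> wd X; apply: eq_exist. Qed.
Next Obligation. by move=> wd X Y Z g h; apply: eq_exist. Qed.

End Spaces.

(* Main.v *)
From mathcomp Require Import all_boot all_order all_algebra.
From mathcomp Require Import all_classical all_reals all_analysis.
From mathcomp Require Import ring lra zify.
Require Import Defs.
Import Order.TTheory GRing.Theory Num.Theory.
Import numFieldNormedType.Exports.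

Set Implicit Arguments.
Unset Strict Implicit.
Unset Printing Implicit Defensive.

Local Open Scope ring_scope.
Local Open Scope classical_set_scope.

(** Write Phi, Pi and Gamma for the three polar operations. A Frolicher structure
    is determined by its functions, since its curves are Gamma F; so the functor
    Xi is injective on objects, and as it leaves maps unchanged, everything
    reduces to two facts about families of functions.

    If F = Phi C with C = Gamma F, then F is a reflexive differential structure.
    Stability under smooth operations is the chain rule along curves
    ([smooth_on_path]); stability under local modification holds because a curve
    along which the functions of F are smooth is continuous for the topology
    induced by F ([Gamma_preimage_open]); and F is reflexive because curves are
    among the parametrisations.

    Conversely, if Phi (Pi F) = F then Phi (Gamma F) = F. Let f be smooth along
    all the curves in Gamma F and let p be in Pi F. For every smooth path gam in
    the domain of p, the curve p o gam belongs to Gamma F, so f o p is smooth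
    along all smooth paths, and Boman's theorem ([smooth_along_paths_smooth_on])
    says that a function with this property is smooth.

    Boman's theorem is the substance of the proof. It suffices to show that a
    function f which is smooth along paths is continuous and has partial
    derivatives which are again smooth along paths; an induction on the order
    then concludes. Continuity follows from the special curve lemma
    ([special_curve]): a sequence that converges fast is interpolated by one
    smooth curve. For the partial derivatives, displacing a path in a fixed
    direction gives a function F (s, t) of two variables that is smooth along
    curves, and g (t) = dF/ds (0, t) must be shown to be smooth; subtracting
    F (0, t), one may assume that F vanishes for s = 0.

    The special curve lemma also shows that the derivatives of F in the first
    variable are locally bounded ([derive1n_locally_bounded]), so that
    F (s, t) = g (t) s + O (s^2) uniformly. Now substitute the curve
    h |-> (h^m, t + h): the function h |-> F (h^m, t + h) is smooth in h, it has
    a Taylor polynomial of order 2m with a uniformly controlled remainder, and it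
    equals g (t + h) h^m + O (h^(2m)). Dividing by h^m gives, uniformly in t, an
    expansion g (t + h) = P_t (h) + O (h^m) with P_t a polynomial of degree less
    than m. By the converse of Taylor's theorem ([converse_taylor]) the
    function g is of class C^(m-1), and m is arbitrary. *)

(** * Smooth functions of one variable *)

Section Curves.
Variable R : realType.
Implicit Types (f g h : R -> R) (x : R).

(** The derivatives are provided as functions, so that closure properties need
    no computation of iterated derivatives. *)
Fixpoint derivable_n n f : Prop :=
  if n is m.+1 then exists f',
    (forall x, is_derive x 1 f (f' x)) /\ derivable_n m f'
  else True.

Lemma derivable_nW n f : derivable_n n.+1 f -> derivable_n n f.
Proof.
elim: n f => [//|n IH] f [f' [df Df]]; exists f'; split => //.
exact: IH.
Qed.

Lemma is_derive1E f f' : (forall x, is_derive x 1 f (f' x)) -> f^`() = f'.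
Proof. by move=> df; apply/funext => x; rewrite derive1E derive_val. Qed.

Lemma derivable_is_derive1 f x : derivable f x 1 -> is_derive x 1 f (f^`() x).
Proof. by move=> fx; rewrite derive1E; exact/derivableP. Qed.

Lemma smooth_curveP f : smooth_curve f <-> forall n, derivable_n n f.
Proof.
split => [fS n|fD n].
  elim: n f fS => [//|n IH] f fS; exists f^`(); split.
    by move=> x; apply: derivable_is_derive1; exact: (fS 0%N).
  by apply: IH => k x; rewrite -derive1Sn; exact: fS.
suff H k h : derivable_n k.+1 h -> forall x, derivable h^`(k) x 1.
  by apply: H; exact: fD.
elim: k h => [|k IH] h [h' [dh Dh]] x.
  by rewrite derive1n0.
by rewrite derive1Sn (is_derive1E dh); exact: IH.
Qed.

Lemma smooth_is_derive f x : smooth_curve f -> is_derive x 1 f (f^`() x).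
Proof. by move=> fS; apply: derivable_is_derive1; exact: (fS 0%N). Qed.

Lemma smooth_derive1 f : smooth_curve f -> smooth_curve f^`().
Proof. by move=> fS n x; rewrite -derive1Sn; exact: fS. Qed.

Lemma smooth_derive1n (n : nat) f : smooth_curve f -> smooth_curve f^`(n).
Proof. by elim: n => [//|n IH] fS; rewrite derive1nS; exact/smooth_derive1/IH. Qed.

Lemma smooth_integrate f f' : (forall x, is_derive x 1 f (f' x)) ->
  smooth_curve f' -> smooth_curve f.
Proof.
move=> df /smooth_curveP Sf'; apply/smooth_curveP => -[//|n].
by exists f'.
Qed.

Lemma derivable_n_cst n c : derivable_n n (fun=> c).
Proof.
elim: n c => [//|n IH] c; exists (fun=> 0); split; last exact: IH.
by move=> x; exact: is_derive_cst.
Qed.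

Lemma derivable_nD n f g : derivable_n n f -> derivable_n n g ->
  derivable_n n (fun x => f x + g x).
Proof.
elim: n f g => [//|n IH] f g [f' [df Df]] [g' [dg Dg]].
exists (fun x => f' x + g' x); split; last exact: IH.
by move=> x; apply: is_deriveD.
Qed.

Lemma derivable_nM n f g : derivable_n n f -> derivable_n n g ->
  derivable_n n (fun x => f x * g x).
Proof.
elim: n f g => [//|n IH] f g Df0 Dg0; move: (Df0) (Dg0) => [f' [df Df]] [g' [dg Dg]].
exists (fun x => f x * g' x + g x * f' x); split.
  by move=> x; apply: is_deriveM.
by apply: derivable_nD; apply: IH => //; exact: derivable_nW.
Qed.

Lemma derivable_n_comp n f g : derivable_n n f -> derivable_n n g ->
  derivable_n n (f \o g).
Proof.
elim: n f g => [//|n IH] f g Df0 Dg0; move: (Df0) (Dg0) => [f' [df Df]] [g' [dg Dg]].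
exists (fun x => f' (g x) * g' x); split.
  by move=> x; apply: is_derive1_comp.
apply: derivable_nM => //; apply: IH => //; exact: derivable_nW.
Qed.

Lemma smooth_cst c : smooth_curve (fun _ : R => c).
Proof. by apply/smooth_curveP => n; exact: derivable_n_cst. Qed.

Lemma smooth_id : smooth_curve (fun x : R => x).
Proof.
apply: (@smooth_integrate _ (fun=> 1)); last exact: smooth_cst.

Qed.

Lemma smoothD f g : smooth_curve f -> smooth_curve g ->
  smooth_curve (fun x => f x + g x).
Proof.
move=> /smooth_curveP Sf /smooth_curveP Sg; apply/smooth_curveP => n.
exact: derivable_nD.
Qed.

Lemma smoothM f g : smooth_curve f -> smooth_curve g ->
  smooth_curve (fun x => f x * g x).
Proof.
move=> /smooth_curveP Sf /smooth_curveP Sg; apply/smooth_curveP => n.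
exact: derivable_nM.
Qed.

Lemma smooth_comp f g : smooth_curve f -> smooth_curve g -> smooth_curve (f \o g).
Proof.
move=> /smooth_curveP Sf /smooth_curveP Sg; apply/smooth_curveP => n.
exact: derivable_n_comp.
Qed.

Lemma smoothZ (c : R) f : smooth_curve f -> smooth_curve (fun x => c * f x).
Proof. exact/smoothM/smooth_cst. Qed.

Lemma smoothN f : smooth_curve f -> smooth_curve (fun x => - f x).
Proof.
move=> /(@smoothZ (-1)); congr smooth_curve.
by apply/funext => x; rewrite mulN1r.
Qed.

Lemma smoothB f g : smooth_curve f -> smooth_curve g ->
  smooth_curve (fun x => f x - g x).
Proof. by move=> Sf /smoothN; exact: smoothD. Qed.

Lemma smoothX n f : smooth_curve f -> smooth_curve (fun x => f x ^+ n).
Proof.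
move=> Sf; elim: n => [|n IH]; first exact: smooth_cst.
have -> : (fun x => f x ^+ n.+1) = (fun x => f x * f x ^+ n).
  by apply/funext => x; rewrite exprS.
exact: smoothM.
Qed.

Lemma smooth_derivable f x : smooth_curve f -> derivable f x 1.
Proof. by move=> Sf; exact: (Sf 0%N). Qed.

Lemma smooth_continuous f : smooth_curve f -> continuous f.
Proof.
move=> Sf x; apply: differentiable_continuous; apply/derivable1_diffP.
exact: smooth_derivable.
Qed.

Lemma near_eq_derive1n n f g x : (\forall y \near x, f y = g y) ->
  \forall y \near x, f^`(n) y = g^`(n) y.
Proof.
elim: n f g => [//|n IH] f g fg; rewrite !derive1Sn; apply: IH.
have := near_join fg; apply: filterS => y yfg.
by rewrite !derive1E; apply: near_eq_derive.
Qed.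

Lemma smooth_local f :
  (forall x, exists2 g, smooth_curve g & \forall y \near x, f y = g y) ->
  smooth_curve f.
Proof.
move=> fl n x; have [g Sg fg] := fl x.
have gf : \forall y \near x, g^`(n) y = f^`(n) y.
  by apply: near_eq_derive1n; apply: filterS fg => y fgy.
by apply: near_eq_derivable gf _; exact: Sg.
Qed.

End Curves.

(** * Flat functions, bumps and truncations *)

Section Flat.
Variable R : realType.
Implicit Types (f g : R -> R) (x : R).

Lemma is_derive_of_quadratic f x (d M delta : R) : 0 < delta ->
  (forall h, `|h| < delta -> `|f (h + x) - f x - d * h| <= M * h ^+ 2) ->
  is_derive x 1 f d.
Proof.
move=> d0 fM.
have M0 : 0 <= `|M| + 1 by rewrite addr_ge0.
have cv : h^-1 *: ((f \o shift x) (h *: (1 : R^o)) - f x) @[h --> 0^'] --> d.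
  apply/cvgrPdist_le => /= e e0; near=> h.
  have h0 : h != 0 by near: h; exact: nbhs_dnbhs_neq.
  rewrite /= -[_ *: 1]/(h * 1) mulr1 -[_ *: _]/(h^-1 * _).
  have -> : d - h^-1 * (f (h + x) - f x) = - (h^-1 * (f (h + x) - f x - d * h)).
    by field.
  rewrite normrN normrM normfV ler_pdivrMl ?normr_gt0//.
  have hd : `|h| < delta by near: h; exact: dnbhs0_lt.
  rewrite (le_trans (fM _ hd))//.
  have he : `|h| <= e / (`|M| + 1).
    by near: h; apply: dnbhs0_le; rewrite divr_gt0 ?ltr_wpDl.
  rewrite -(real_normK (num_real h)) expr2 mulrCA ler_wpM2l//.
  move: he; rewrite ler_pdivlMr ?ltr_wpDl// => /(le_trans _); apply.
  by rewrite mulrC ler_wpM2l// (le_trans (ler_norm M))// lerDl.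
by apply: DeriveDef; [apply/cvg_ex; exists d|exact/cvg_lim].
Unshelve. all: by end_near. Qed.

Lemma exp_decay (y : R) n : 0 <= y -> y ^+ n * expR (- y) <= n`!%:R.
Proof.
move=> y0; rewrite expRN ler_pdivrMr ?expR_gt0//.
case: n => [|n]; first by rewrite expr0 fact0 mul1r; rewrite -expR0 ler_expR.
have := expR_ge1Dxn n y0; rewrite -ler_pdivrMl ?ltr0n ?fact_gt0// mulrC.
by apply: le_trans; rewrite lerDr.
Qed.

(** The functions p (1/x) exp (-1/x) form a class that is stable under derivation,
    which is why all of them are smooth: each vanishes to order two at 0, because
    the exponential beats any power of 1/x. *)
Definition flat_fun (p : {poly R}) x :=
  if 0 < x then p.[x^-1] * expR (- x^-1) else 0.

Lemma flat_fun_bound p : exists M, forall x, `|flat_fun p x| <= M * x ^+ 2.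
Proof.
exists (\sum_(i < size p) `|p`_i| * (i.+2)`!%:R) => x.
rewrite /flat_fun; case: ifPn => [x0|_]; last first.
  by rewrite normr0 mulr_ge0 ?sqr_ge0// sumr_ge0.
have y0 : 0 <= x^-1 by rewrite invr_ge0 ltW.
rewrite normrM [`|expR _|]ger0_norm ?expR_ge0// horner_coef.
rewrite (le_trans (ler_wpM2r (expR_ge0 _) (ler_norm_sum _ _ _)))// !mulr_suml.
apply: ler_sum => i _; rewrite normrM -!mulrA ler_wpM2l//.
rewrite ger0_norm ?exprn_ge0// -ler_pdivrMr ?exprn_gt0//.
apply: le_trans (exp_decay i.+2 y0).
rewrite mulrAC ler_wpM2r ?expR_ge0// -exprVn.
by rewrite -exprD addn2.
Qed.

Lemma is_derive_flat_fun p x :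
  is_derive x 1 (flat_fun p) (flat_fun ((p - p^`()%R) * 'X^2) x).
Proof.
have [x0|x0|->] := ltgtP x 0.
- rewrite {2}/flat_fun ltNge (ltW x0)/=.
  apply: (@near_eq_is_derive _ _ _ (cst (0 : R))).
  near=> y; rewrite /flat_fun ltNge ltW//=.
  by near: y; exact: lt_nbhsl.
- rewrite {2}/flat_fun x0.
  apply: (@near_eq_is_derive _ R R (fun y : R => p.[y^-1] * expR (- y^-1) : R)).
    near=> y; rewrite /flat_fun ifT//.
    by near: y; exact: lt_nbhsr.
  have xn0 : x != 0 by rewrite gt_eqF.
  have dV : is_derive x 1 (fun y : R => y^-1) (- x^-1 ^+ 2).
    apply: DeriveDef; first exact: derivableV.
    rewrite (@deriveV _ _ id x (1:R) xn0 (@derivable_id R R x 1))//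
      derive_id -[_ *: _]/(_ * _) mulr1.
    by rewrite exprVn.
  have d1 : is_derive x 1 (horner p \o (fun y : R => y^-1))
      (p^`()%R.[x^-1] * - x^-1 ^+ 2).
    by apply: is_derive1_comp.
  have d2 : is_derive x 1 (expR \o (fun y : R => - y^-1)) (expR (- x^-1) * x^-1 ^+ 2).
    apply: is_derive1_comp.
    by apply: is_derive_eq; rewrite opprK.
  apply: (is_derive_eq (is_deriveM d1 d2)).
  rewrite /= -![_ *: _]/(_ * _) hornerM hornerXn hornerD hornerN; ring.
- have [M pM] := flat_fun_bound p.
  rewrite {2}/flat_fun ltxx.
  apply: (@is_derive_of_quadratic _ _ _ M 1) => // h _.
  by rewrite addr0 {2}/flat_fun ltxx mul0r !subr0.
Unshelve. all: by end_near. Qed.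

Lemma smooth_flat_fun p : smooth_curve (flat_fun p).
Proof.
apply/smooth_curveP => n; elim: n p => [//|n IH] p.
by eexists; split; [move=> x; exact: is_derive_flat_fun|exact: IH].
Qed.

Let theta := flat_fun 1.

Let theta_gt0 x : 0 < x -> 0 < theta x.
Proof. by move=> x0; rewrite /theta /flat_fun x0 hornerE ?mul1r expR_gt0. Qed.

Let theta_le0 x : x <= 0 -> theta x = 0.
Proof. by move=> x0; rewrite /theta /flat_fun ltNge x0. Qed.

Let theta_ge0 x : 0 <= theta x.
Proof. by have [/theta_le0 ->|/theta_gt0/ltW] := leP x 0. Qed.

Let theta_le x y : x <= y -> theta x <= theta y.
Proof.
move=> xy; have [/theta_le0 -> //|x0] := leP x 0.
have y0 := lt_le_trans x0 xy.
rewrite /theta /flat_fun x0 y0 !hornerE ?mul1r ler_expR lerN2.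
by rewrite lef_pV2.
Qed.

(** With theta (x) = exp (-1/x) for x > 0 and C theta (3/4) = 1, the function
    theta (1 - C theta (x^2 - 1/4)) is constant as long as its inner theta
    vanishes, that is for |x| <= 1/2, and vanishes as soon as the inner theta
    exceeds 1/C, in particular for |x| >= 1. *)
Lemma bump_exists : exists beta : R -> R,
  [/\ smooth_curve beta, forall x, 0 <= beta x <= 1,
      forall x, `|x| <= 2^-1 -> beta x = 1 &
      forall x, 1 <= `|x| -> beta x = 0].
Proof.
pose C := (theta (3 / 4))^-1.
have t34 : 0 < theta (3 / 4) by apply: theta_gt0; lra.
have t1 : 0 < theta 1 by apply: theta_gt0.
pose beta x := (theta 1)^-1 * theta (1 - C * theta (x ^+ 2 - 1 / 4)).
have C0 : 0 <= C by rewrite invr_ge0.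
exists beta; split.
- apply: smoothZ.
  apply: (@smooth_comp _ theta (fun x => 1 - C * theta (x ^+ 2 - 1 / 4))).
    exact: smooth_flat_fun.
  apply: smoothB; first exact: smooth_cst.
  apply: smoothZ; apply: (@smooth_comp _ theta (fun x => x ^+ 2 - 1 / 4)).
    exact: smooth_flat_fun.
  by apply: smoothB; [apply: smoothX; exact: smooth_id|exact: smooth_cst].
- move=> x; rewrite mulr_ge0 ?invr_ge0//= ler_pdivrMl// mulr1; apply: theta_le.
  by rewrite gerBl mulr_ge0.
- move=> x x2; rewrite /beta (theta_le0 (x := x ^+ 2 - _)).
    by rewrite mulr0 subr0 mulVf ?gt_eqF.
  rewrite -real_normK ?num_real//.
  have := normr_ge0 x; nra.
- move=> x x1; rewrite /beta (theta_le0 (x := 1 - _)) ?mulr0//.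
  have C1 : C * theta (3 / 4) = 1 by rewrite mulVf ?gt_eqF.
  rewrite subr_le0 -[leLHS]C1 ler_wpM2l//; apply: theta_le.
  have := exprn_ege1 2 x1; rewrite real_normK ?num_real//; lra.
Qed.

(** Composing with such a truncation makes functions that are only defined near
    a point globally defined, without changing them near that point. *)
Lemma truncation_exists (delta : R) : 0 < delta -> exists chi : R -> R,
  [/\ smooth_curve chi, forall x, `|chi x| <= delta &
      forall x, `|x| <= delta / 2 -> chi x = x].
Proof.
move=> d0; have [beta [Sb b01 b1 b0]] := bump_exists.
exists (fun x => x * beta (delta^-1 * x)); split.
- apply: smoothM; first exact: smooth_id.
  by apply: (@smooth_comp _ beta) => //; exact/smoothZ/smooth_id.
- move=> x; rewrite normrM; have [xd|xd] := leP `|x| delta.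
    have /andP[? ?] := b01 (delta^-1 * x).
    by rewrite [`|beta _|]ger0_norm// (le_trans _ xd)// ler_piMr.
  rewrite b0 ?normr0 ?mulr0 ?ltW// normrM ger0_norm ?invr_ge0 ?ltW//.
  by rewrite ltr_pdivlMl// mulr1.
- move=> x xd; rewrite b1 ?mulr1// normrM gtr0_norm ?invr_gt0//.
  by rewrite ler_pdivrMl.
Qed.

End Flat.

(** * The special curve lemma *)

Section Glue.
Variable R : realType.
Implicit Types (B : R -> R) (e : nat -> R) (x : R).

Lemma sum_half N : \sum_(0 <= n < N) (2 : R) ^- n <= 2.
Proof.
suff -> : \sum_(0 <= n < N) (2 : R) ^- n = 2 - 2 * 2 ^- N.
  by rewrite gerBl mulr_ge0.
elim: N => [|N IH]; first by rewrite big_nil expr0 invr1; ring.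
by rewrite big_nat_recr//= IH exprS; field; rewrite expf_neq0.
Qed.

(** The terms are rescaled copies of B centred at 2^-n with radius 2^-n / 4;
    on ]0, +oo[ the sum is locally finite when B is supported in [-1, 1], and
    the cut-off index makes it a genuine finite sum. *)
Definition glue B e x :=
  if 0 < x then
    \sum_(0 <= n < (Num.truncn (2 / x)).+1) e n * B (4 * (2 ^+ n * x) - 4)
  else 0.

Let glue_tail n x : 0 < x -> (Num.truncn (2 / x) < n)%N -> 2 < 2 ^+ n * x.
Proof.
move=> x0 nx; rewrite -ltr_pdivrMr//.
apply: lt_le_trans (truncnS_gt _) _.
rewrite (le_trans (_ : _ <= n%:R))// ?ler_nat//.
by rewrite -natrX ler_nat ltnW// ltn_expl.
Qed.

Lemma glueE B e x N : (forall y, 1 < `|y| -> B y = 0) -> 0 < x ->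
  (Num.truncn (2 / x) < N)%N ->
  glue B e x = \sum_(0 <= n < N) e n * B (4 * (2 ^+ n * x) - 4).
Proof.
move=> B0 x0 xN; rewrite /glue x0 [RHS](big_cat_nat _ xN)//=.
rewrite [X in _ = _ + X]big_nat_cond [X in _ = _ + X]big1 ?addr0// => n.
rewrite andbT => /andP[/(glue_tail x0) n2 _]; rewrite B0 ?mulr0//.
by rewrite ger0_norm; lra.
Qed.

Definition rapidly_decreasing e :=
  forall k, exists M, forall n, `|e n| * 2 ^+ (n * k) <= M.

Lemma rapidly_decreasingM e : rapidly_decreasing e ->
  rapidly_decreasing (fun n => e n * (4 * 2 ^+ n)).
Proof.
move=> re k; have [M Me] := re k.+1; exists (4 * M) => n.
rewrite !normrM (ger0_norm (_ : 0 <= 4))// [`|_ ^+ _|]ger0_norm ?exprn_ge0//.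
have := Me n; rewrite mulnS exprD; nra.
Qed.

(** A term that does not vanish at x has 2^-n of the order of x, and fast
    decrease of the coefficients then leaves x^2 2^-n. *)
Lemma glue_quadratic B e (K : R) : (forall y, 1 < `|y| -> B y = 0) ->
  (forall y, `|B y| <= K) -> rapidly_decreasing e ->
  exists M, forall x, `|glue B e x| <= M * x ^+ 2.
Proof.
move=> B0 BK re; have [M eM] := re 3%N.
have K0 : 0 <= K by rewrite (le_trans _ (BK 0)).
have M0 : 0 <= M by rewrite (le_trans _ (eM 0%N))// mulr_ge0 ?exprn_ge0.
exists (2 * M * K * 2) => x; rewrite /glue; case: ifPn => [x0|_]; last first.
  by rewrite normr0 mulr_ge0 ?sqr_ge0// !mulr_ge0.
apply: le_trans (ler_norm_sum _ _ _) _.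
apply: (@le_trans _ _ (\sum_(0 <= n < (Num.truncn (2 / x)).+1)
    (2 * M * K * x ^+ 2) * 2 ^- n)); last first.
  have -> : 2 * M * K * 2 * x ^+ 2 = 2 * M * K * x ^+ 2 * 2 by ring.
  by rewrite -mulr_sumr ler_wpM2l ?sum_half// mulr_ge0 ?sqr_ge0// !mulr_ge0.
apply: ler_sum => n _; rewrite normrM.
have [y1|y1] := leP `|4 * (2 ^+ n * x) - 4| 1; last first.
  rewrite B0// normr0 mulr0 mulr_ge0 ?invr_ge0 ?exprn_ge0//.
  by rewrite mulr_ge0 ?sqr_ge0// !mulr_ge0.
have p0 : 0 < 2 ^+ n :> R by rewrite exprn_gt0.
have px : 3 / 4 <= 2 ^+ n * x by move: y1; rewrite ler_norml; lra.
rewrite ler_pdivlMr//.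
have -> : 2 * M * K * x ^+ 2 = K * (2 * M * x ^+ 2) by ring.
rewrite [`|e n| * _]mulrC -[leLHS]mulrA ler_pM// ?mulr_ge0// ?exprn_ge0//.
rewrite -(ler_pM2r (exprn_gt0 2 p0)).
have -> : `|e n| * 2 ^+ n * (2 ^+ n) ^+ 2 = `|e n| * 2 ^+ (n * 3) by rewrite exprM; ring.
apply: le_trans (eM n) _.
have -> : 2 * M * x ^+ 2 * (2 ^+ n) ^+ 2 = M * (2 * (2 ^+ n * x) ^+ 2) by ring.
rewrite ler_peMr//; nra.
Qed.

Lemma bounded_of_support B : smooth_curve B ->
  (forall y, 1 < `|y| -> B y = 0) -> exists K, forall y, `|B y| <= K.
Proof.
move=> SB B0.
have cB : {within `[(-1 : R), 1], continuous B}.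
  by apply: continuous_subspaceT; exact: smooth_continuous.
have N11 : -1 <= 1 :> R by lra.
have [c _ cmax] := EVT_max N11 cB.
have [d _ dmin] := EVT_min N11 cB.
exists (`|B c| + `|B d|) => y; have [y1|y1] := leP `|y| 1; last first.
  by rewrite B0// normr0 addr_ge0.
have yin : y \in `[(-1 : R), 1]%R by rewrite in_itv/= -ler_norml.
rewrite ler_norml; apply/andP; split.
  rewrite (le_trans _ (dmin _ yin))// lerNl.
  by rewrite (le_trans (ler_norm _))// normrN lerDr.
by rewrite (le_trans (cmax _ yin))// (le_trans (ler_norm _))// lerDl.
Qed.

Lemma derive1_support B : (forall y, 1 < `|y| -> B y = 0) ->
  forall y, 1 < `|y| -> B^`() y = 0.
Proof.
move=> B0 y y1; rewrite derive1E -(derive_cst (0 : R) y 1).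
apply: near_eq_derive; near=> z; apply: B0.
by near: z; apply: (cvgr_gt _ (@norm_continuous _ _ y)).
Unshelve. all: by end_near. Qed.

(** The derivative of a glued function is a glued function, with coefficients
    multiplied by 4 * 2^n, and these still decrease fast; at 0 the quadratic
    bound is all that is needed. *)
Lemma is_derive_glue B e x : smooth_curve B ->
  (forall y, 1 < `|y| -> B y = 0) -> rapidly_decreasing e ->
  is_derive x 1 (glue B e) (glue B^`() (fun n => e n * (4 * 2 ^+ n)) x).
Proof.
move=> SB B0 re; have [x0|x0|->] := ltgtP x 0.
- rewrite {2}/glue ltNge (ltW x0)/=.
  apply: (@near_eq_is_derive _ _ _ (cst (0 : R))).
  near=> y; rewrite /glue ltNge ltW//=.
  by near: y; exact: lt_nbhsl.
- pose N := (Num.truncn (2 / (x / 2))).+1.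
  have NE y : x / 2 < y -> (Num.truncn (2 / y) < N)%N.
    move=> xy; rewrite ltnS; apply: le_truncn.
    by rewrite ler_wpM2l// lef_pV2 ?posrE// ?ltW// ?divr_gt0// (lt_trans _ xy)// divr_gt0.
  have xx : x / 2 < x by lra.
  rewrite (@glueE _ _ _ N)//; [|exact: derive1_support|exact: NE].
  apply: (@near_eq_is_derive _ R R
    (fun y : R => \sum_(0 <= n < N) e n * B (4 * (2 ^+ n * y) - 4))).
    near=> y; have xy : x / 2 < y by near: y; exact: lt_nbhsr.
    by rewrite (@glueE _ _ _ N)// ?NE// (lt_trans _ xy)// divr_gt0.
  rewrite big_mkord.
  rewrite (_ : (fun y : R => _) =
      \sum_(i < N) (fun y : R => e i * B (4 * (2 ^+ i * y) - 4))); last first.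
    by apply/funext => y; rewrite big_mkord fct_sumE.
  apply: is_derive_sum => n.
  have dl : is_derive x 1 (fun y : R => 4 * (2 ^+ n * y) - 4) (4 * 2 ^+ n).
    apply: (@is_derive_of_quadratic _ _ _ _ 0 1) => // h _.
    by rewrite mul0r normr_le0; apply/eqP; ring.
  have dB := smooth_is_derive (4 * (2 ^+ n * x) - 4) SB.
  have D := @is_derive1_comp _ B (fun y : R => 4 * (2 ^+ n * y) - 4) x _ _ dB dl.
  apply: (is_derive_eq (is_deriveZ (e n) D)).
  by rewrite -[_ *: _]/(_ * _); ring.
- have [K BK] := bounded_of_support SB B0.
  have [M gM] := glue_quadratic B0 BK re.
  rewrite {2}/glue ltxx.
  apply: (@is_derive_of_quadratic _ _ _ _ M 1) => // h _.
  by rewrite addr0 {2}/glue ltxx mul0r !subr0.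
Unshelve. all: by end_near. Qed.

Lemma smooth_glue B e : smooth_curve B ->
  (forall y, 1 < `|y| -> B y = 0) -> rapidly_decreasing e ->
  smooth_curve (glue B e).
Proof.
move=> SB B0 re; apply/smooth_curveP => n.
elim: n B e SB B0 re => [//|n IH] B e SB B0 re; eexists; split.
  by move=> x; exact: is_derive_glue.
apply: IH; [exact: smooth_derive1|exact: derive1_support|].
exact: rapidly_decreasingM.
Qed.

(** The supports of the terms are pairwise disjoint: each one lies between 3/4
    and 5/4 of the corresponding power of 1/2. *)
Lemma glue_near B e x m : (forall y, 1 < `|y| -> B y = 0) ->
  `|x - 2 ^- m| <= 2 ^- m / 8 -> glue B e x = e m * B (4 * (2 ^+ m * x) - 4).
Proof.
move=> B0 xm.
have p0 n : 0 < 2 ^+ n :> R by rewrite exprn_gt0.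
have {}xm : `|2 ^+ m * x - 1| <= 1 / 8.
  have -> : 2 ^+ m * x - 1 = 2 ^+ m * (x - 2 ^- m) by field; rewrite gt_eqF.
  by rewrite normrM gtr0_norm// mulrC -ler_pdivlMr// mul1r mulrC.
have {xm} [xl xu] : 7 / 8 <= 2 ^+ m * x /\ 2 ^+ m * x <= 9 / 8.
  by move: xm; rewrite ler_norml; lra.
have x0 : 0 < x by rewrite -(pmulr_rgt0 _ (p0 m)); lra.
rewrite (@glueE _ _ _ (maxn m.+1 (Num.truncn (2 / x)).+1))// ?leq_maxr//.
rewrite (bigD1_seq m) ?iota_uniq ?mem_index_iota ?leq_maxl//=.
rewrite big1 ?addr0// => n nm; rewrite B0 ?mulr0//.
have := p0 n; have := p0 m; case: (ltngtP n m) nm => // nm _.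
  have : 2 * 2 ^+ n <= 2 ^+ m :> R by rewrite -exprS ler_eXn2l// ltr1n.
  by rewrite ltr_normr => ? ? ?; apply/orP; right; nra.
have : 2 * 2 ^+ m <= 2 ^+ n :> R by rewrite -exprS ler_eXn2l// ltr1n.
by rewrite ltr_normr => ? ? ?; apply/orP; left; nra.
Qed.

Lemma glue_le B e x (d : R) : (forall y, `|B y| <= 1) ->
  (forall n, `|e n| <= d * 2 ^- n) -> `|glue B e x| <= 2 * d.
Proof.
move=> B1 ed; have d0 : 0 <= d.
  by have := le_trans (normr_ge0 _) (ed 0%N); rewrite expr0 invr1 mulr1.
rewrite /glue; case: ifPn => _; last by rewrite normr0 mulr_ge0.
apply: le_trans (ler_norm_sum _ _ _) _.
apply: (@le_trans _ _ (\sum_(0 <= n < (Num.truncn (2 / x)).+1) d * 2 ^- n)).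
  apply: ler_sum => n _; rewrite normrM (le_trans _ (ed n))//.
  by rewrite ler_piMr.
by rewrite -mulr_sumr mulrC ler_wpM2r// sum_half.
Qed.

Lemma rapidly_decreasing_sqr e (d : R) :
  (forall n, `|e n| <= d * 2 ^- (n * n)) -> rapidly_decreasing e.
Proof.
move=> ed k; exists (d * 2 ^+ (k * k)) => n.
have d0 : 0 <= d.
  by have := le_trans (normr_ge0 _) (ed 0%N); rewrite expr0 invr1 mulr1.
apply: le_trans (ler_wpM2r _ (ed n)) _; first exact: exprn_ge0.
rewrite -mulrA ler_wpM2l// ler_pdivrMl ?exprn_gt0// -exprD.
rewrite ler_eXn2l ?ltr1n//; nia.
Qed.

(** The affine pieces are a_n beta (y) + b'_n y beta (y) in the rescaled variable
    y = 4 (2^n u - 1), where the bump beta is 1 for |y| <= 1/2. *)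
Lemma special_curve (a b : nat -> R) (d : R) :
  (forall n, `|a n| <= d * 2 ^- (n * n)) ->
  (forall n, `|b n| <= d * 2 ^- (n * n)) ->
  exists c : R -> R, [/\ smooth_curve c, c 0 = 0, forall u, `|c u| <= 4 * d &
    forall n u, `|u - 2 ^- n| <= 2 ^- n / 8 -> c u = a n + b n * (u - 2 ^- n)].
Proof.
move=> ad bd; have [beta [Sb b01 b1 b0]] := bump_exists R.
pose beta1 y := y * beta y; pose b' n := b n / (4 * 2 ^+ n).
have p0 n : 0 < 2 ^+ n :> R by rewrite exprn_gt0.
have p1 n : 1 <= 2 ^+ n :> R by rewrite exprn_ege1// ler1n.
have d0 : 0 <= d by have := le_trans (normr_ge0 _) (ad 0%N); rewrite expr0 invr1 mulr1.
have b'd n : `|b' n| <= d * 2 ^- (n * n).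
  rewrite normrM (le_trans _ (bd n))// ler_piMr// normfV ger0_norm ?mulr_ge0//.
  by rewrite invf_le1 ?mulr_gt0//; have := p1 n; lra.
have sqrW e : (forall n, `|e n| <= d * 2 ^- (n * n)) -> forall n, `|e n| <= d * 2 ^- n.
  move=> ed n; rewrite (le_trans (ed n))// ler_wpM2l// lef_pV2 ?posrE//.
  by rewrite ler_eXn2l ?ltr1n//; nia.
have Sb1 : smooth_curve beta1 by apply: smoothM => //; exact: smooth_id.
have b0' y : 1 < `|y| -> beta y = 0 by move=> /ltW/b0.
have b10 y : 1 < `|y| -> beta1 y = 0 by move=> /b0'; rewrite /beta1 => ->; rewrite mulr0.
have nb y : `|beta y| <= 1 by have /andP[? ?] := b01 y; rewrite ger0_norm.
have nb1 y : `|beta1 y| <= 1.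
  have [y1|/b10 ->] := leP `|y| 1; last by rewrite normr0.
  by rewrite normrM mulr_ile1.
exists (fun u => glue beta a u + glue beta1 b' u); split.
- by apply: smoothD; apply: smooth_glue => //; exact: rapidly_decreasing_sqr.
- by rewrite /glue ltxx addr0.
- move=> u; rewrite (le_trans (ler_normD _ _))//.
  have -> : 4 * d = 2 * d + 2 * d by ring.
  by rewrite lerD// glue_le//; exact: sqrW.
- move=> n u un; rewrite !(glue_near _ _ un)//.
  have E : 4 * (2 ^+ n * u) - 4 = 4 * 2 ^+ n * (u - 2 ^- n).
    by field; rewrite gt_eqF.
  have bE : beta (4 * (2 ^+ n * u) - 4) = 1.
    apply: b1; rewrite E normrM ger0_norm ?mulr_ge0//.
    rewrite -ler_pdivlMl ?mulr_gt0// (le_trans un)//.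
    by rewrite le_eqVlt; apply/orP; left; apply/eqP; field; rewrite gt_eqF.
  by rewrite /beta1 bE !mulr1 E /b'; field; rewrite gt_eqF.
Qed.

End Glue.

(** * Functions of two variables that are smooth along curves *)

Section AlongCurves.
Variable R : realType.

Definition smooth_along_curves2 (F : R -> R -> R) : Prop :=
  forall a b : R -> R, smooth_curve a -> smooth_curve b ->
    smooth_curve (fun u => F (a u) (b u)).

Lemma smooth_along_curves2_l F t : smooth_along_curves2 F -> smooth_curve (F^~ t).
Proof. by move=> FS; apply: FS; [exact: smooth_id|exact: smooth_cst]. Qed.

Lemma smooth_along_curves2_r F s : smooth_along_curves2 F -> smooth_curve (F s).
Proof. by move=> FS; apply: FS; [exact: smooth_cst|exact: smooth_id]. Qed.

Lemma derive1n_affine (f : R -> R) (a b p : R) k : smooth_curve f ->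
  derive1n k (fun u => f (a + b * (u - p))) =
  fun u => b ^+ k * (derive1n k f) (a + b * (u - p)).
Proof.
move=> Sf; elim: k => [|k IH].
  by apply/funext => u; rewrite !derive1n0 mul1r.
rewrite !derive1nS IH; apply: is_derive1E => x.
have Dl : is_derive x 1 (fun u : R => a + b * (u - p)) b.
  apply: (@is_derive_of_quadratic _ _ _ _ 0 1) => // h _.
  by rewrite mul0r normr_le0; apply/eqP; ring.
have Df := smooth_is_derive (a + b * (x - p)) (@smooth_derive1n _ k _ Sf).
have D := @is_derive1_comp _ (derive1n k f) (fun u : R => a + b * (u - p)) x _ _ Df Dl.
apply: (is_derive_eq (is_deriveZ (b ^+ k) D)).
by rewrite -[_ *: _]/(_ * _) exprS; ring.
Qed.

Lemma exists_half_pow (e M : R) : 0 < e -> exists n, 2 ^- n < e /\ M < n%:R.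
Proof.
move=> e0; pose n := maxn (Num.truncn e^-1).+1 (Num.truncn M).+1.
exists n; split; last first.
  by rewrite (lt_le_trans (truncnS_gt _))// ler_nat leq_maxr.
rewrite -[e]invrK ltf_pV2 ?posrE ?exprn_gt0 ?invr_gt0//.
apply: lt_le_trans (truncnS_gt _) _.
rewrite (@le_trans _ _ n%:R) ?ler_nat ?leq_maxl//.
by rewrite -natrX ler_nat ltnW// ltn_expl.
Qed.

(** Otherwise one could choose points converging fast at which the derivative
    explodes even faster, and a smooth curve passing through them with a speed
    that tends to 0 fast, but slowly compared to this explosion: along it the
    k-th derivative of F would be unbounded near 0. *)
Lemma derive1n_locally_bounded F (t0 : R) k : smooth_along_curves2 F ->
  exists C delta : R, 0 < delta /\ forall s t, `|s| <= delta -> `|t - t0| <= delta ->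
    `|(derive1n k (F^~ t)) s| <= C.
Proof.
move=> FS; apply/not_existsP => unb.
have bad (n : nat) : exists st : R * R, [/\ `|st.1| <= 2 ^- (n * n),
    `|st.2 - t0| <= 2 ^- (n * n) &
    n%:R * (2 ^+ (n * n)) ^+ k < `|(derive1n k (F^~ st.2)) st.1|].
  apply: contrapT => Nst; apply: (unb (n%:R * (2 ^+ (n * n)) ^+ k)).
  exists (2 ^- (n * n)); split; first by rewrite invr_gt0 exprn_gt0.
  move=> s t sn tn; rewrite leNgt; apply/negP => lt.
  by apply: Nst; exists (s, t).
have {bad} [st stP] := choice bad.
have [c1 [Sc1 c10 _ c1E]] := @special_curve R (fun n => (st n).1)
  (fun n => 2 ^- (n * n)) 1
  ltac:(by move=> n; have [+ _ _] := stP n; rewrite mul1r)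
  ltac:(by move=> n; rewrite mul1r ger0_norm// invr_ge0 exprn_ge0).
have [c2 [Sc2 c20 _ c2E]] := @special_curve R (fun n => (st n).2 - t0)
  (fun n => 0) 1
  ltac:(by move=> n; have [_ + _] := stP n; rewrite mul1r)
  ltac:(by move=> n; rewrite mul1r normr0 invr_ge0 exprn_ge0).
(* The speed at 2^-n in the first variable is 2^-(n^2), hence the factor of phiE. *)
pose phi u := F (c1 u) (t0 + c2 u).
have Sphi : smooth_curve phi.
  by apply: FS => //; apply: smoothD => //; exact: smooth_cst.
have phiE n : derive1n k phi (2 ^- n) =
    (2 ^- (n * n)) ^+ k * (derive1n k (F^~ (st n).2)) (st n).1.
  have : \forall u \near (2 ^- n : R),
      phi u = F ((st n).1 + 2 ^- (n * n) * (u - 2 ^- n)) (st n).2.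
    have r0 : 0 < 2 ^- n / 8 :> R by rewrite divr_gt0// invr_gt0 exprn_gt0.
    near=> u; have un : `|u - 2 ^- n| <= 2 ^- n / 8.
      rewrite distrC; near: u.
      by have /cvgrPdist_le := @cvg_id _ (nbhs (2 ^- n : R)); apply.
    by rewrite /phi (c1E n)// (c2E n)//; congr (F _ _); ring.
  move=> /(near_eq_derive1n k)/nbhs_singleton ->.
  rewrite (@derive1n_affine (F^~ (st n).2) _ _ _ k (@smooth_along_curves2_l F _ FS)).
  by rewrite subrr mulr0 addr0.
have cphi := smooth_continuous (@smooth_derive1n _ k _ Sphi).
have /cvgrPdist_le/(_ 1 ltr01)/nbhs_ballP[e /= e0 He] := cphi 0.
have [n [ne nM]] := exists_half_pow (`|(derive1n k phi) 0| + 1) e0.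
have : `|(derive1n k phi) (2 ^- n)| <= `|(derive1n k phi) 0| + 1.
  rewrite -[X in `|X|](subrK ((derive1n k phi) 0)) addrC (le_trans (ler_normD _ _))//.
  rewrite lerD2l distrC; apply: He.
  by rewrite /ball/= sub0r normrN gtr0_norm// invr_gt0 exprn_gt0.
apply/negP; rewrite -ltNge (lt_le_trans nM)// phiE normrM.
have [_ _ /ltW big] := stP n.
have p0 : 0 < (2 ^+ (n * n)) ^+ k :> R by rewrite !exprn_gt0.
rewrite exprVn gtr0_norm ?invr_gt0//.
by rewrite ler_pdivlMl// mulrC.
Unshelve. all: by end_near. Qed.

End AlongCurves.


(** * Taylor's theorem and its converse *)

Section Taylor.
Variable R : realType.

Lemma mean_value (f f' : R -> R) (x : R) :
  (forall y : R, `|y| <= `|x| -> is_derive y 1 f (f' y)) ->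
  exists2 c, `|c| <= `|x| & f x - f 0 = f' c * x.
Proof.
move=> df.
have cf (a b : R) : (forall y, y \in `[a, b]%R -> `|y| <= `|x|) ->
    {within `[a, b], continuous f}.
  move=> abx; apply: derivable_within_continuous => y /abx yx.
  by have [] := df y yx.
have [x0|x0] := leP 0 x.
- have yx y : y \in `[0, x]%R -> `|y| <= `|x|.
    by rewrite in_itv/= => /andP[y0 yx]; rewrite !ger0_norm.
  have [c cx ->] := MVT_segment x0
    (fun y yi => df y (yx y (subset_itv_oo_cc yi))) (cf _ _ yx).
  by exists c; [exact: yx|rewrite subr0].
- have yx y : y \in `[x, 0]%R -> `|y| <= `|x|.
    rewrite in_itv/= => /andP[xy y0].
    by rewrite !ler0_norm ?lerN2// ltW.
  have [c cx E] := MVT_segment (ltW x0)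
    (fun y yi => df y (yx y (subset_itv_oo_cc yi))) (cf _ _ yx).
  by exists c; [exact: yx|rewrite -opprB E sub0r mulrN opprK].
Qed.

Definition taylor_poly N (f : R -> R) : {poly R} :=
  \poly_(j < N) ((derive1n j f) 0 / j`!%:R).

Lemma deriv_taylor_poly N f : (taylor_poly N.+1 f)^`()%R = taylor_poly N (derive1 f).
Proof.
apply/polyP => i; rewrite coef_deriv !coef_poly ltnS; case: ifP => _.
  rewrite derive1Sn factS natrM -mulr_natr; field.
  by rewrite nat1r !pnatr_eq0 -lt0n fact_gt0.
by rewrite mul0rn.
Qed.

(** The remainder of order N + 1 of f vanishes at 0 and its derivative is the
    remainder of order N of f', to which the mean value theorem applies. *)
Lemma taylor_bound N (f : R -> R) (delta C : R) : smooth_curve f ->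
  (forall x, `|x| <= delta -> `|(derive1n N f) x| <= C) ->
  forall x, `|x| <= delta -> `|f x - (taylor_poly N f).[x]| <= C * `|x| ^+ N.
Proof.
elim: N f => [|N IH] f Sf fC x xd.
  rewrite expr0 mulr1 (_ : taylor_poly 0 f = 0) ?horner0 ?subr0; first exact: fC.
  by apply/polyP => i; rewrite coef_poly coef0.
pose r y := f y - (taylor_poly N.+1 f).[y].
have dr (y : R) : is_derive y 1 r ((derive1 f) y - (taylor_poly N (derive1 f)).[y]).
  rewrite -deriv_taylor_poly.
  exact: is_deriveB (smooth_is_derive y Sf) (is_derive_poly _ _).
have r0 : r 0 = 0 by rewrite /r horner_coef0 coef_poly/= fact0 divr1 subrr.
have -> : f x - (taylor_poly N.+1 f).[x] = r x - r 0 by rewrite r0 subr0.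
rewrite exprSr mulrA.
have [y yx ->] := mean_value (fun y (_ : `|y| <= `|x|) => dr y).
rewrite normrM ler_wpM2r//.
have C0 : 0 <= C by rewrite (le_trans _ (fC x xd)).
apply: le_trans (IH _ (smooth_derive1 Sf) _ _ _) _.
- by move=> z zd; rewrite -derive1Sn; exact: fC.
- exact: le_trans yx xd.
- by rewrite ler_wpM2l// lerXn2r ?nnegrE.
Qed.

(** The combination p (x) - 2^m p (x/2) has no term of degree m, and its other
    coefficients are at least as large as those of p. *)
Let coef_bound_sum m : exists2 L : R, 0 <= L & forall (a : nat -> R) (K : R),
  (forall x, `|x| <= 1 -> `|\sum_(j < m) a j * x ^+ j| <= K) ->
  forall i, (i < m)%N -> `|a i| <= L * K.
Proof.
elim: m => [|m [L L0 IH]]; first by exists 0.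
exists (1 + m.+1%:R * (L * (1 + 2 ^+ m))) => [|a K aK].
  by rewrite addr_ge0// !mulr_ge0// addr_ge0// exprn_ge0.
have K0 : 0 <= K by rewrite (le_trans _ (aK 0 _))// normr0.
have p0 n : 0 < 2 ^+ n :> R by rewrite exprn_gt0.
have low i : (i < m)%N -> `|a i| <= L * (1 + 2 ^+ m) * K.
  move=> im; pose b j := a j * (1 - 2 ^+ m / 2 ^+ j).
  have bi : `|b i| <= L * ((1 + 2 ^+ m) * K).
    apply: IH => // x x1.
    have -> : \sum_(j < m) b j * x ^+ j = \sum_(j < m.+1) a j * x ^+ j
        - 2 ^+ m * \sum_(j < m.+1) a j * (x / 2) ^+ j.
      rewrite mulr_sumr -sumrB big_ord_recr/= exprMn exprVn.
      rewrite [X in _ + X](_ : _ = 0); last by field; rewrite gt_eqF.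
      rewrite addr0; apply: eq_bigr => j _; rewrite /b exprMn exprVn.
      by field; rewrite gt_eqF.
    rewrite (le_trans (ler_normB _ _))// mulrDl mul1r lerD ?aK//.
    rewrite normrM gtr0_norm// ler_wpM2l ?(ltW (p0 _))// aK//.
    by rewrite normrM normfV [`|2|]ger0_norm// ler_pdivrMr// (le_trans x1)// mul1r ler1n.
  rewrite -mulrA (le_trans _ bi)// normrM ler_peMr//.
  have : 2 <= 2 ^+ m / 2 ^+ i :> R.
    by rewrite ler_pdivlMr// -exprS ler_eXn2l// ltr1n.
  by rewrite ler_normr; lra.
have B0 : 0 <= L * (1 + 2 ^+ m) * K by rewrite !mulr_ge0// addr_ge0// ltW.
move=> i; rewrite ltnS leq_eqVlt => /predU1P[->|im].
  have -> : a m = \sum_(j < m.+1) a j * 1 ^+ j - \sum_(j < m) a j.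
    rewrite big_ord_recr/= expr1n mulr1 addrAC.
    under eq_bigr do rewrite expr1n mulr1.
    by rewrite subrr add0r.
  rewrite (le_trans (ler_normB _ _))// mulrDl mul1r lerD ?aK ?normr1//.
  rewrite (le_trans (ler_norm_sum _ _ _))//.
  apply: (@le_trans _ _ (\sum_(j < m) L * (1 + 2 ^+ m) * K)).
    by apply: ler_sum => j _; exact: low.
  by rewrite sumr_const card_ord -[leRHS]mulrA mulr_natl ler_wpMn2l.
rewrite (le_trans (low _ im))// ler_wpM2r//.
have : 1 * (L * (1 + 2 ^+ m)) <= m.+1%:R * (L * (1 + 2 ^+ m)).
  by rewrite ler_wpM2r ?ler1n// mulr_ge0// addr_ge0// ltW.
lra.
Qed.

(** On polynomials of bounded size all norms are equivalent; the powers of r come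
    from rescaling the disk of radius r to the unit disk. *)
Lemma poly_coef_bound m : exists2 L : R, 0 <= L & forall (p : {poly R}) (r K : R),
  (size p <= m)%N -> 0 < r -> (forall x, `|x| <= r -> `|p.[x]| <= K) ->
  forall i, `|p`_i| * r ^+ i <= L * K.
Proof.
have [L L0 HL] := coef_bound_sum m; exists L => // p r K pm r0 pK i.
have [im|im] := ltnP i m; last first.
  rewrite nth_default ?(leq_trans pm)// normr0 mul0r mulr_ge0//.
  by rewrite (le_trans _ (pK 0 _))// normr0 ltW.
have -> : `|p`_i| * r ^+ i = `|p`_i * r ^+ i|.
  by rewrite normrM [`|_ ^+ _|]ger0_norm// exprn_ge0// ltW.
apply: (HL (fun j => p`_j * r ^+ j)) => // x x1.
rewrite (_ : \sum_(j < m) _ = p.[r * x]); last first.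
  by rewrite (horner_coef_wide _ pm); apply: eq_bigr => j _; rewrite exprMn mulrA.
by apply: pK; rewrite normrM gtr0_norm// ler_piMr// ltW.
Qed.

Lemma poly_first_order (p : {poly R}) : exists M, forall x, `|x| <= 1 ->
  `|p.[x] - p`_0 - p`_1 * x| <= M * x ^+ 2.
Proof.
pose q := drop_poly 2 p.
exists (\sum_(i < size q) `|q`_i|) => x x1.
have -> : p.[x] - p`_0 - p`_1 * x = q.[x] * x ^+ 2.
  rewrite -{1}(poly_take_drop 2 p) hornerD hornerM hornerXn.
  rewrite (horner_coef_wide _ (size_take_poly 2 p)) !big_ord_recr big_ord0/=.
  by rewrite !coef_take_poly/= -/q; ring.
rewrite normrM [`|x ^+ 2|]ger0_norm ?sqr_ge0// ler_wpM2r ?sqr_ge0//.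
rewrite horner_coef (le_trans (ler_norm_sum _ _ _))// ler_sum// => i _.
by rewrite normrM ler_piMr// normrX exprn_ile1.
Qed.

(** Comparing the expansions at t and at t + h on the disk of radius |h| shows
    that the coefficient of index i at t + h is given by re-expanding the
    polynomial at t, up to an error of order m - i. *)
Lemma converse_taylor m (g : R -> R) (P : R -> {poly R}) (t0 delta C : R) :
  (forall t, (size (P t) <= m)%N) ->
  (forall t h, `|t - t0| < delta -> `|h| < delta ->
     `|g (t + h) - (P t).[h]| <= C * `|h| ^+ m) ->
  forall t i, `|t - t0| < delta -> (i.+1 < m)%N ->
  is_derive t 1 (fun t => (P t)`_i) ((P t)`_i.+1 *+ i.+1).
Proof.
move=> Pm gP t i td im.
have [L L0 HL] := poly_coef_bound m.
have d0 : 0 < delta by rewrite (le_lt_trans _ td).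
have C0 : 0 <= C.
  have := gP t (delta / 2) td; rewrite gtr0_norm ?divr_gt0// => H.
  have h : delta / 2 < delta by lra.
  by have := le_trans (normr_ge0 _) (H h); rewrite pmulr_lge0// exprn_gt0// divr_gt0.
have [M HM] := poly_first_order (P t)^`N(i).
pose eta := Num.min 1 (Num.min (delta / 2) (delta - `|t - t0|)).
have eta0 : 0 < eta by rewrite !lt_min ltr01 divr_gt0//= subr_gt0.
apply: (@is_derive_of_quadratic _ _ _ _ (M + L * (C * (2 ^+ m + 1))) eta) => // h.
rewrite !lt_min => /and3P[h1 h2 h3].
have [->|hn0] := eqVneq h 0.
  by rewrite add0r subrr mulr0 subr0 normr0 expr0n mulr0.
have hp : 0 < `|h| by rewrite normr_gt0.
pose q := \poly_(j < m) ((P t)^`N(j).[h] - (P (h + t))`_j).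
have qE x : q.[x] = (P t).[h + x] - (P (h + t)).[x].
  rewrite horner_poly (nderiv_taylor_wide (mulrC _ _) (Pm t)).
  rewrite (horner_coef_wide _ (Pm (h + t))) -sumrB.
  by apply: eq_bigr => j _; rewrite mulrBl.
have htd : `|h + t - t0| < delta.
  by rewrite -addrA (le_lt_trans (ler_normD _ _))//; lra.
have qi : `|q`_i| * `|h| ^+ i <= L * (C * (2 ^+ m + 1) * `|h| ^+ m).
  apply: HL => //; first exact: size_poly.
  move=> x xh; rewrite qE.
  have -> : (P t).[h + x] - (P (h + t)).[x] =
      (g (h + t + x) - (P (h + t)).[x]) - (g (t + (h + x)) - (P t).[h + x]).
    by rewrite addrA (addrC t h); ring.
  rewrite (le_trans (ler_normB _ _))//.
  have xd : `|x| < delta by lra.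
  have hx2 : `|h + x| <= 2 * `|h| by rewrite (le_trans (ler_normD _ _))//; lra.
  have hxd : `|h + x| < delta by lra.
  have := gP _ _ htd xd; have := gP _ _ td hxd.
  have : C * `|x| ^+ m <= C * `|h| ^+ m by rewrite ler_wpM2l// lerXn2r ?nnegrE.
  have : C * `|h + x| ^+ m <= C * (2 ^+ m * `|h| ^+ m).
    by rewrite ler_wpM2l// -exprMn lerXn2r ?nnegrE// mulr_ge0.
  lra.
have {}qi : `|q`_i| <= L * (C * (2 ^+ m + 1)) * h ^+ 2.
  rewrite -(ler_pM2r (exprn_gt0 i hp)) (le_trans qi)//.
  rewrite -[h ^+ 2]real_normK ?num_real// -[leRHS]mulrA -exprD mulrA.
  rewrite ler_wpM2l ?mulr_ge0// ?addr_ge0// ?exprn_ge0//.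
  by rewrite ler_wiXn2l ?ltW//; lia.
have q_i : q`_i = (P t)^`N(i).[h] - (P (h + t))`_i.
  by rewrite coef_poly (ltn_trans _ im).
have := HM h (ltW h1); rewrite !coef_nderivn addn0 binn mulr1n addn1 binSn.
move=> H.
have -> : (P (h + t))`_i - (P t)`_i - (P t)`_i.+1 *+ i.+1 * h =
    (P t)^`N(i).[h] - (P t)`_i - (P t)`_i.+1 *+ i.+1 * h - q`_i.
  by rewrite q_i; ring.
by rewrite (le_trans (ler_normB _ _))// mulrDl lerD.
Qed.

(** By the previous lemma the coefficient of index j is the j-th derivative of g
    divided by j!, as long as j is less than the order of the expansion. *)
Lemma smooth_of_taylor_expansions (g : R -> R) :
  (forall m t0, exists (P : R -> {poly R}) (delta C : R), [/\ 0 < delta,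
     forall t, (size (P t) <= m.+1)%N &
     forall t h, `|t - t0| < delta -> `|h| < delta ->
       `|g (t + h) - (P t).[h]| <= C * `|h| ^+ m.+1]) ->
  smooth_curve g.
Proof.
move=> gT k t0; have [P [delta [C [d0 Pm gP]]]] := gT k.+1 t0.
have D := converse_taylor Pm gP.
have near_t t : `|t - t0| < delta -> \forall u \near t, `|u - t0| < delta.
  have c : `|u - t0| @[u --> t] --> `|t - t0|.
    by apply: cvg_norm; apply: cvgB; [exact: cvg_id|exact: cvg_cst].
  by move=> td; exact: cvgr_lt c _ td.
have t0d : `|t0 - t0| < delta by rewrite subrr normr0.
have gE j : (j <= k)%N -> forall t, `|t - t0| < delta ->
    (derive1n j g) t = j`!%:R * (P t)`_j.
  elim: j => [_|j IH jk] t td.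
    rewrite derive1n0 fact0 mul1r -horner_coef0; apply/eqP.
    have := gP t 0 td; rewrite normr0 addr0 expr0n mulr0 normr_le0 subr_eq0.
    exact.
  have Dj : is_derive t 1 (fun t => j`!%:R * (P t)`_j)
      (j`!%:R * ((P t)`_j.+1 *+ j.+1)).
    apply: (@is_deriveZ _ _ _ (fun t => (P t)`_j) _ _ _ _ (D t j td _)).
    by rewrite !ltnS ltnW.
  have : is_derive t 1 (derive1n j g) (j`!%:R * ((P t)`_j.+1 *+ j.+1)).
    apply: near_eq_is_derive Dj.
    by apply: filterS (near_t _ td) => u ud; rewrite (IH (ltnW jk)).
  move=> Dg; rewrite derive1nS derive1E derive_val factS -mulr_natr natrM; ring.
have Dk : is_derive t0 1 (fun t => k`!%:R * (P t)`_k)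
    (k`!%:R * ((P t0)`_k.+1 *+ k.+1)).
  exact: (@is_deriveZ _ _ _ (fun t => (P t)`_k) _ _ _ _ (D t0 k t0d _)).
apply: near_eq_derivable (ex_derive (is_derive := Dk)).
by apply: filterS (near_t _ t0d) => u ud; rewrite gE.
Qed.

End Taylor.

(** * The transverse derivative *)

Section TransverseDerivative.
Variable R : realType.
Implicit Types F : R -> R -> R.

Lemma smooth_along_curves2_shear F m : smooth_along_curves2 F ->
  smooth_along_curves2 (fun s t => F (s ^+ m) (t + s)).
Proof. by move=> FS a b Sa Sb; apply: FS; [exact: smoothX|exact: smoothD]. Qed.

(** Comparing coefficients on the disk of radius r, those of index less than m
    are O (r^(m-i)) for all small r, hence vanish. *)
Lemma poly_divides_Xn (p : {poly R}) m (delta K : R) : 0 < delta ->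
  (forall x, `|x| <= delta -> `|p.[x]| <= K * `|x| ^+ m) ->
  p = drop_poly m p * 'X^m.
Proof.
move=> d0 pK; rewrite -{1}(poly_take_drop m p).
suff -> : take_poly m p = 0 by rewrite add0r.
apply/polyP => i; rewrite coef_take_poly coef0; case: ifPn => // im.
have [L L0 HL] := poly_coef_bound R (size p).
have K0 : 0 <= K.
  have := le_trans (normr_ge0 _) (pK delta _); rewrite gtr0_norm// lexx.
  by move=> /(_ isT); rewrite pmulr_lge0// exprn_gt0.
apply/eqP; rewrite -normr_le0; apply/ler_addgt0Pl => e e0; rewrite addr0.
pose r := Num.min 1 (Num.min delta (e / (L * K + 1))).
have LK : 0 < L * K + 1 by rewrite ltr_wpDl// mulr_ge0.
have r0 : 0 < r by rewrite !lt_min ltr01 d0 divr_gt0.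
have /and3P[r1 rd re] : [&& r <= 1, r <= delta & r <= e / (L * K + 1)].
  by rewrite -!le_min.
have := HL p r (K * r ^+ m) (leqnn _) r0 _ i.
have pr x : `|x| <= r -> `|p.[x]| <= K * r ^+ m.
  move=> xr; rewrite (le_trans (pK _ (le_trans xr rd)))// ler_wpM2l//.
  by rewrite lerXn2r ?nnegrE// ltW.
move=> /(_ pr) H; rewrite -(ler_pM2r (exprn_gt0 i r0)) (le_trans H)//.
apply: (@le_trans _ _ (L * K * (r * r ^+ i))).
  rewrite mulrA ler_wpM2l ?mulr_ge0// -exprS.
  by rewrite ler_wiXn2l ?(ltW r0).
rewrite mulrA ler_wpM2r ?exprn_ge0 ?(ltW r0)//.
move: re; rewrite ler_pdivlMr//; apply: le_trans.
by rewrite mulrC ler_wpM2l ?(ltW r0)// lerDl.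
Qed.

Lemma eq0_of_punctured_bound (d : R -> R) (C delta : R) m : 0 < delta ->
  {for 0, continuous d} ->
  (forall x, x != 0 -> `|x| < delta -> `|d x| <= C * `|x| ^+ m.+1) -> d 0 = 0.
Proof.
move=> d0 cd dC; apply/eqP; rewrite -normr_le0; apply/ler_addgt0Pl => e e0.
rewrite addr0.
have /cvgrPdist_le/(_ (e / 2)) := cd; rewrite divr_gt0// => /(_ isT)/nbhs_ballP.
move=> [r /= r0 Hr].
pose x := Num.min (r / 2) (Num.min (delta / 2) (Num.min 1 (e / (2 * (`|C| + 1))))).
have C1 : 0 < 2 * (`|C| + 1) by rewrite mulr_gt0// ltr_wpDl.
have x0 : 0 < x by rewrite !lt_min !divr_gt0//= ltr01.
have /and4P[xr xd x1 xe] :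
    [&& x <= r / 2, x <= delta / 2, x <= 1 & x <= e / (2 * (`|C| + 1))].
  by rewrite -!le_min.
have /Hr/= dx : ball 0 r x by rewrite /ball/= sub0r normrN gtr0_norm//; lra.
have xd' : `|x| < delta by rewrite gtr0_norm//; lra.
have := dC x _ xd'; rewrite gt_eqF// => /(_ isT); rewrite [`|x|]gtr0_norm// => dCx.
have : C * x ^+ m.+1 <= e / 2.
  apply: (@le_trans _ _ ((`|C| + 1) * x)).
    apply: (@le_trans _ _ (`|C| * x ^+ m.+1)).
      by rewrite ler_wpM2r ?ler_norm// exprn_ge0// ltW.
    rewrite ler_pM// ?lerDl// ?exprn_ge0 ?(ltW x0)//.
    by rewrite exprS ler_piMr ?(ltW x0)// exprn_ile1 ?(ltW x0).
  move: xe; rewrite ler_pdivlMr//; lra.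
have -> : d 0 = (d 0 - d x) + d x by ring.
have := ler_normD (d 0 - d x) (d x); lra.
Qed.

Section Core.
Variable F : R -> R -> R.
Hypothesis FS : smooth_along_curves2 F.
Hypothesis F0 : forall t, F 0 t = 0.

Let g t := derive1 (F^~ t) 0.

Let second_order t0 : exists C delta : R, 0 < delta /\ forall s t,
  `|s| <= delta -> `|t - t0| <= delta -> `|F s t - g t * s| <= C * s ^+ 2.
Proof.
have [C [delta [d0 FC]]] := @derive1n_locally_bounded _ _ t0 2 FS.
exists C, delta; split => // s t sd td.
have := taylor_bound (@smooth_along_curves2_l _ _ t FS) (fun s sd => FC s t sd td) sd.
rewrite real_normK ?num_real// /taylor_poly horner_poly !big_ord_recr big_ord0/=.
by rewrite F0 !mul0r !add0r divr1.
Qed.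

(** g is the locally uniform limit of the continuous functions F (s, t) / s. *)
Let g_continuous : continuous g.
Proof.
move=> t0; apply/cvgrPdist_le => e e0.
have [C [delta [d0 FC]]] := second_order t0.
pose s := Num.min delta (e / (3 * (`|C| + 1))).
have C1 : 0 < 3 * (`|C| + 1) by rewrite mulr_gt0// ltr_wpDl.
have s0 : 0 < s by rewrite lt_min d0 divr_gt0.
have /andP[sd se] : (s <= delta) && (s <= e / (3 * (`|C| + 1))) by rewrite -le_min.
have quo t : `|t - t0| <= delta -> `|F s t / s - g t| <= e / 3.
  move=> td; have -> : F s t / s - g t = (F s t - g t * s) / s.
    by field; rewrite gt_eqF.
  rewrite normrM normfV [`|s|]gtr0_norm// ler_pdivrMr//.
  rewrite (le_trans (FC _ _ _ td)) ?gtr0_norm//.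
  move: se; rewrite ler_pdivlMr// => se.
  have : C * s <= (`|C| + 1) * s.
    by rewrite ler_wpM2r ?ltW// (le_lt_trans (ler_norm C))// ltrDl.
  nra.
have cF : continuous (fun t => F s t / s).
  move=> t; apply: cvgM; last exact: cvg_cst.
  exact: smooth_continuous (@smooth_along_curves2_r _ _ s FS) t.
have /cvgrPdist_le/(_ (e / 3)) := cF t0; rewrite divr_gt0// => /(_ isT) cF0.
near=> t.
have td : `|t - t0| <= delta.
  rewrite distrC; near: t.
  by have /cvgrPdist_le := @cvg_id _ (nbhs t0); apply.
have q0 := quo t0; rewrite subrr normr0 ltW// in q0; have {}q0 := q0 isT.
have qt := quo t td.
have cFt : `|F s t0 / s - F s t / s| <= e / 3 by near: t.
have -> : g t0 - g t = (F s t / s - g t) - (F s t0 / s - g t0)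
    + (F s t0 / s - F s t / s) by ring.
rewrite (le_trans (ler_normD _ _))//.
have := ler_normB (F s t / s - g t) (F s t0 / s - g t0); lra.
Unshelve. all: by end_near. Qed.

(** Put M = m + 1. Along the curve h |-> (h^M, t + h) the function F is
    g (t + h) h^M up to an error of order 2M; dividing the Taylor polynomial of
    this smooth function of h by h^M yields an expansion of g at t to order M. *)
Let g_expansion m t0 : exists (P : R -> {poly R}) (delta C : R), [/\ 0 < delta,
  forall t, (size (P t) <= m.+1)%N &
  forall t h, `|t - t0| < delta -> `|h| < delta ->
    `|g (t + h) - (P t).[h]| <= C * `|h| ^+ m.+1].
Proof.
pose M := m.+1; pose H h t := F (h ^+ M) (t + h).
have HS : smooth_along_curves2 H by exact: smooth_along_curves2_shear.
have [C1 [d1 [d10 FC1]]] := second_order t0.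
have [C2 [d2 [d20 FC2]]] := @derive1n_locally_bounded _ _ t0 1 FS.
have [C3 [d3 [d30 FC3]]] := @derive1n_locally_bounded _ _ t0 (M + M) HS.
pose Q t := taylor_poly (M + M) (H^~ t).
pose delta := Num.min 1 (Num.min (d1 / 2) (Num.min (d2 / 2) d3)).
have d0 : 0 < delta by rewrite !lt_min ltr01 d30 !divr_gt0.
have /and4P[dl1 dld1 dld2 dld3] :
    [&& delta <= 1, delta <= d1 / 2, delta <= d2 / 2 & delta <= d3].
  by rewrite -!le_min.
have main t h : `|t - t0| < delta -> `|h| <= delta ->
    `|g (t + h) * h ^+ M - (Q t).[h]| <= (C1 + C3) * `|h| ^+ (M + M).
  move=> td hd.
  have h1 : `|h| <= 1 by lra.
  have thd : `|t + h - t0| <= d1.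
    by rewrite addrAC (le_trans (ler_normD _ _))//; lra.
  have hM : `|h ^+ M| <= `|h|.
    by rewrite normrX exprS ler_piMr// exprn_ile1.
  have hMd : `|h ^+ M| <= d1 by lra.
  have A := FC1 _ _ hMd thd.
  have B : `|H h t - (Q t).[h]| <= C3 * `|h| ^+ (M + M).
    apply: (@taylor_bound _ _ (H^~ t) d3 C3 (@smooth_along_curves2_l _ _ t HS)).
      by move=> s sd; apply: FC3 => //; lra.
    lra.
  have -> : g (t + h) * h ^+ M - (Q t).[h] =
    (H h t - (Q t).[h]) - (F (h ^+ M) (t + h) - g (t + h) * h ^+ M).
    by rewrite /H; ring.
  rewrite (le_trans (ler_normB _ _))// addrC mulrDl lerD//.
  have <- : (h ^+ M) ^+ 2 = `|h| ^+ (M + M).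
    by rewrite -real_normK ?num_real// normrX -exprM muln2 addnn.
  exact: A.
have gC2 t h : `|t - t0| < delta -> `|h| <= delta -> `|g (t + h)| <= C2.
  move=> td hd; rewrite /g -derive1n1; apply: FC2; first by rewrite normr0 ltW.
  by rewrite addrAC (le_trans (ler_normD _ _))//; lra.
have Qdiv t : `|t - t0| < delta -> Q t = drop_poly M (Q t) * 'X^M.
  move=> td; apply: (@poly_divides_Xn _ _ delta (C2 + `|C1 + C3|)) => // h hd.
  have -> : (Q t).[h] = g (t + h) * h ^+ M - (g (t + h) * h ^+ M - (Q t).[h]).
    by ring.
  rewrite (le_trans (ler_normB _ _))// mulrDl lerD//.
    by rewrite normrM normrX ler_wpM2r ?exprn_ge0// gC2.
  rewrite (le_trans (main _ _ td hd))//.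
  rewrite (le_trans (ler_wpM2r _ (ler_norm _))) ?exprn_ge0// ler_wpM2l//.
  by rewrite ler_wiXn2l ?leq_addr//; lra.
exists (fun t => drop_poly M (Q t)), delta, (C1 + C3); split => //.
  by move=> t; rewrite size_drop_poly leq_subLR size_poly.
move=> t h td hd.
have off x : x != 0 -> `|x| < delta ->
    `|g (t + x) - (drop_poly M (Q t)).[x]| <= (C1 + C3) * `|x| ^+ M.
  move=> x0 xd; have xM : 0 < `|x| ^+ M by rewrite exprn_gt0 ?normr_gt0.
  rewrite -(ler_pM2r xM) -mulrA -exprD -{1}normrX -normrM mulrBl.
  have := main t x td (ltW xd); rewrite {1}(Qdiv t td).
  by rewrite hornerM hornerXn.
(* Division by h^M is not possible at h = 0, where continuity of g is used. *)
have [->|h0] := eqVneq h 0; last exact: off.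
rewrite (_ : g (t + 0) - _ = 0) ?normr0 ?expr0n ?mulr0//.
apply: (@eq0_of_punctured_bound
  (fun x => g (t + x) - (drop_poly M (Q t)).[x]) (C1 + C3) delta m) => //.
apply: cvgB; last exact: continuous_horner.
apply: (@continuous_comp _ _ _ (fun x => t + x) g); last exact: g_continuous.
by apply: cvgD; [exact: cvg_cst|exact: cvg_id].
Qed.

Lemma smooth_transverse_derivative0 : smooth_curve g.
Proof. exact: smooth_of_taylor_expansions g_expansion. Qed.

End Core.

Lemma smooth_transverse_derivative F : smooth_along_curves2 F ->
  smooth_curve (fun t => derive1 (F^~ t) 0).
Proof.
move=> FS; pose G s t := F s t - F 0 t.
have GS : smooth_along_curves2 G.
  move=> a b Sa Sb; apply: smoothB; first exact: FS.
  exact: (smooth_comp (@smooth_along_curves2_r _ _ 0 FS) Sb).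
have G0 t : G 0 t = 0 by rewrite /G subrr.
rewrite (_ : (fun t => _) = (fun t => derive1 (G^~ t) 0)).
  exact: smooth_transverse_derivative0.
apply/funext => t; rewrite !derive1E; apply/esym.
rewrite (@deriveB _ _ _ (F^~ t) (cst (F 0 t))) ?derive_cst ?subr0//.
exact: smooth_derivable (@smooth_along_curves2_l _ _ t FS).
Qed.

End TransverseDerivative.

(** * Boman's theorem *)

Section Rows.
Variables (R : realType) (n : nat).
Implicit Types (v w x : 'rV[R]_n) (U : set 'rV[R]_n).

Lemma row_entry_le v i : `|v 0 i| <= `|v|.
Proof.
rewrite [leRHS]/Num.Def.normr/= mx_normrE.
exact: (le_bigmax _ (fun ij => `|v ij.1 ij.2|) (0, i)).
Qed.

Lemma row_norm_le v (r : R) : 0 <= r -> (forall i, `|v 0 i| <= r) -> `|v| <= r.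
Proof.
move=> r0 vr; rewrite [leLHS]/Num.Def.normr/= mx_normrE.
by apply: bigmax_le => // -[i j] _ /=; rewrite ord1.
Qed.

Lemma open_closed_ball U x : open U -> U x ->
  exists2 r : R, 0 < r & forall v, `|v - x| <= r -> U v.
Proof.
move=> oU Ux; have /nbhs_ballP[r /= r0 rU] := open_nbhs_nbhs (conj oU Ux).
exists (r / 2); first by rewrite divr_gt0.
move=> v vx; apply: rU; rewrite -ball_normE/= distrC (le_lt_trans vx)//.
by rewrite ltr_pdivrMr// ltr_pMr// ltr1n.
Qed.

Lemma continuous_rowP (f : 'rV[R]_n -> R) x : {for x, continuous f} <->
  forall e : R, 0 < e -> exists2 d : R, 0 < d &
    forall y, `|y - x| < d -> `|f x - f y| < e.
Proof.
split=> [/(@cvgrPdist_lt R R _ (nbhs x) (nbhs_filter x)) cf e e0|cf].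
  have /nbhs_ballP[d /= d0 Hd] := cf e e0; exists d => // y yx.
  by apply: Hd; rewrite -ball_normE/= distrC.
apply/(@cvgrPdist_lt R R _ (nbhs x) (nbhs_filter x)) => e e0.
have [d d0 Hd] := cf e e0; apply/nbhs_ballP; exists d => //= y.
by rewrite -ball_normE/= distrC; exact: Hd.
Qed.

Definition smooth_path (gam : R -> 'rV[R]_n) : Prop :=
  forall i, smooth_curve (fun t => gam t 0 i).

Definition smooth_along_paths U (f : 'rV[R]_n -> R) : Prop :=
  forall gam, smooth_path gam -> (forall t, U (gam t)) ->
    smooth_curve (fun t => f (gam t)).

Lemma smooth_path_near gam (t0 r : R) : smooth_path gam -> 0 < r ->
  \forall t \near t0, `|gam t - gam t0| <= r.
Proof.
move=> gamS r0.
have : \forall t \near t0, forall i, `|gam t0 0 i - gam t 0 i| <= r.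
  apply: (@filter_forall R _ (fun i =>
    [set t | `|gam t0 0 i - gam t 0 i| <= r]) (nbhs t0) (nbhs_filter t0)) => i.
  by have /cvgrPdist_le/(_ r r0) := @smooth_continuous _ _ (gamS i) t0.
apply: filterS => t tr; rewrite distrC; apply: row_norm_le; first exact: ltW.
by move=> i; rewrite !mxE.
Qed.

Let line_growth (f : 'rV[R]_n -> R) v x (s : R) :
  (fun h : R => h^-1 *: (((fun s : R => f (s *: v + x)) \o shift s) (h *: (1 : R))
     - f (s *: v + x))) =
  (fun h : R => h^-1 *: ((f \o shift (s *: v + x)) (h *: v) - f (s *: v + x))).
Proof.
by apply/funext => h; rewrite /= -[_ *: 1]/(h * 1) mulr1 scalerDl addrA.
Qed.

Lemma derivable_lineP (f : 'rV[R]_n -> R) v x (s : R) :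
  derivable (fun s : R => f (s *: v + x)) s 1 <-> derivable f (s *: v + x) v.
Proof. by rewrite /derivable line_growth. Qed.

Lemma derive1_line (f : 'rV[R]_n -> R) v x (s : R) :
  derive1 (fun s : R => f (s *: v + x)) s = 'D_v f (s *: v + x).
Proof. by rewrite derive1E /derive line_growth. Qed.

End Rows.

Section Boman.
Variables (R : realType) (n : nat).
Implicit Types (x : 'rV[R]_n) (U : set 'rV[R]_n) (f : 'rV[R]_n -> R).

(** If f stayed away from f x along a sequence of points converging to x, a
    subsequence converging fast would lie on a smooth path through x. *)
Lemma smooth_along_paths_continuous U f x : open U -> U x ->
  smooth_along_paths U f -> {for x, continuous f}.
Proof.
move=> oU Ux fS; have [r r0 rU] := open_closed_ball oU Ux.
apply/continuous_rowP => e e0; apply: contrapT => Nc.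
pose d := r / 4; have d0 : 0 < d by rewrite divr_gt0.
have bad (k : nat) : exists y, `|y - x| <= d * 2 ^- (k * k) /\ e <= `|f x - f y|.
  apply: contrapT => Ny; apply: Nc.
  exists (d * 2 ^- (k * k)); first by rewrite mulr_gt0// invr_gt0 exprn_gt0.
  move=> y xy; rewrite ltNge; apply/negP => ye.
  by apply: Ny; exists y; split => //; exact: ltW.
have {bad} [y yP] := choice bad.
have curve (i : 'I_n) : exists c : R -> R, [/\ smooth_curve c, c 0 = 0,
    forall u, `|c u| <= r & forall k, c (2 ^- k) = (y k - x) 0 i].
  have [||c [Sc c0 cd cE]] := @special_curve R (fun k => (y k - x) 0 i) (fun=> 0) d.
  - by move=> k; have [yk _] := yP k; exact: le_trans (row_entry_le _ _) yk.
  - by move=> k; rewrite normr0 mulr_ge0 ?(ltW d0)// invr_ge0 exprn_ge0.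
  exists c; split => //.
    by move=> u; rewrite (le_trans (cd u))// /d mulrC divfK.
  move=> k; rewrite (cE k) ?mul0r ?addr0//.
  by rewrite subrr normr0 divr_ge0// invr_ge0 exprn_ge0.
have {curve} [c cP] := choice curve.
pose gam u := x + \row_i c i u.
have gamS : smooth_path gam.
  move=> i; rewrite (_ : (fun t => _) = (fun t => x 0 i + c i t)).
    by have [Sc _ _ _] := cP i; apply: smoothD => //; exact: smooth_cst.
  by apply/funext => t; rewrite !mxE.
have gamU u : U (gam u).
  apply: rU; rewrite addrC addKr; apply: row_norm_le; first exact: ltW.
  by move=> i; rewrite mxE; have [_ _ cr _] := cP i.
have gam0 : gam 0 = x.
  by apply/rowP => i; rewrite !mxE; have [_ -> _ _] := cP i; rewrite addr0.
have gamk k : gam (2 ^- k) = y k.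
  by apply/rowP => i; rewrite !mxE; have [_ _ _ ->] := cP i; rewrite !mxE addrC subrK.
have /cvgrPdist_lt/(_ e e0)/nbhs_ballP[a /= a0 Ha] :=
  @smooth_continuous _ _ (fS _ gamS gamU) 0.
have [k [ka _]] := exists_half_pow 0 a0.
have [_] := yP k; apply/negP; rewrite -ltNge -[x]gam0 -(gamk k); apply: Ha.
by rewrite /ball/= sub0r normrN gtr0_norm// invr_gt0 exprn_gt0.
Qed.

Lemma smooth_along_paths_derivable U f x i : open U -> U x ->
  smooth_along_paths U f -> derivable f x (delta_mx 0 i).
Proof.
move=> oU Ux fS; have [r r0 rU] := open_closed_ball oU Ux.
have [chi [Schi chir chiE]] := truncation_exists r0.
pose gam s := chi s *: delta_mx 0 i + x.
have gamS : smooth_path gam.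
  move=> j; rewrite (_ : (fun t => _) =
      (fun t => chi t * delta_mx (0 : 'I_1) i 0 j + x 0 j)).
    apply: smoothD; last exact: smooth_cst.
    by apply: smoothM => //; exact: smooth_cst.
  by apply/funext => t; rewrite !mxE.
have gamU s : U (gam s).
  apply: rU; rewrite addrK; apply: row_norm_le; first exact: ltW.
  move=> j; rewrite !mxE normrM (le_trans _ (chir s))// ler_piMr//.
  by case: (_ && _); rewrite ?normr1 ?normr0.
have : derivable (fun s : R => f (s *: delta_mx 0 i + x)) 0 1.
  have near0 : \forall s \near (0 : R), f (gam s) = f (s *: delta_mx 0 i + x).
    have r20 : 0 < r / 2 by rewrite divr_gt0.
    by apply: filterS (@nbhs0_le _ R _ r20) => s sr; rewrite /gam chiE.
  apply: near_eq_derivable near0 _; exact: smooth_derivable (fS _ gamS gamU).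
by move/derivable_lineP; rewrite scale0r add0r.
Qed.

(** Moving along a path while displacing it in the i-th direction gives a
    function of two variables, smooth along curves, whose transverse derivative
    is the partial derivative of f along the path; truncations keep the moved
    point in U. *)
Lemma smooth_along_paths_derive U f i : open U -> smooth_along_paths U f ->
  smooth_along_paths U ('D_(delta_mx 0 i) f).
Proof.
move=> oU fS gam gamS gamU; apply: smooth_local => t0.
have [r r0 rU] := open_closed_ball oU (gamU t0).
have r20 : 0 < r / 2 by rewrite divr_gt0.
have /nbhs_ballP[d /= d0 Hd] := smooth_path_near t0 gamS r20.
have d20 : 0 < d / 2 by rewrite divr_gt0.
have [chi [Schi chir chiE]] := truncation_exists r20.
have [rho [Srho rhod rhoE]] := truncation_exists d20.
pose tau t := t0 + rho (t - t0).
have Stau : smooth_curve tau.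
  apply: smoothD; first exact: smooth_cst.
  apply: (@smooth_comp _ rho (fun t => t - t0)) => //.
  by apply: smoothB; [exact: smooth_id|exact: smooth_cst].
pose F s t := f (chi s *: delta_mx 0 i + gam (tau t)).
have FS : smooth_along_curves2 F.
  move=> a b Sa Sb; apply: (fS (fun u => chi (a u) *: delta_mx 0 i + gam (tau (b u)))).
    move=> j; rewrite (_ : (fun t => _) = (fun u =>
        chi (a u) * delta_mx (0 : 'I_1) i 0 j + gam (tau (b u)) 0 j)).
      apply: smoothD.
        apply: smoothM; last exact: smooth_cst.
        exact: smooth_comp Schi Sa.
      exact: (smooth_comp (gamS j) (smooth_comp Stau Sb)).
    by apply/funext => t; rewrite !mxE.
  move=> u; apply: rU; rewrite -addrA (le_trans (ler_normD _ _))//.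
  rewrite [r]splitr lerD//.
    rewrite normrZ (le_trans _ (chir (a u)))// ler_piMr//.
    apply: row_norm_le => // j; rewrite !mxE.
    by case: (_ && _); rewrite ?normr1 ?normr0.
  apply: Hd; rewrite /ball/= /tau opprD addNKr normrN.
  by rewrite (le_lt_trans (rhod _))// ltr_pdivrMr// ltr_pMr// ltr1n.
exists (fun t => derive1 (F^~ t) 0); first exact: smooth_transverse_derivative.
have d40 : 0 < d / 2 / 2 by rewrite divr_gt0.
near=> t.
have tt : `|t - t0| <= d / 2 / 2.
  rewrite distrC; near: t.
  by have /cvgrPdist_le/(_ _ d40) := @cvg_id _ (nbhs t0).
have -> : gam t = gam (tau t) by rewrite /tau rhoE// addrC subrK.
rewrite -[X in derive f X _]add0r -[X in derive f (X + _) _](scale0r (delta_mx 0 i)).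
rewrite -derive1_line !derive1E; apply: near_eq_derive.
have r40 : 0 < r / 2 / 2 by rewrite divr_gt0.
by apply: filterS (@nbhs0_le _ R _ r40) => s sr; rewrite /F chiE.
Unshelve. all: by end_near. Qed.

(** Boman's theorem: continuity and existence of the partial derivatives hold for
    every function that is smooth along paths, and this property is inherited by
    the partial derivatives. *)
Lemma smooth_along_paths_smooth_on U f : open U -> smooth_along_paths U f ->
  smooth_on U f.
Proof.
move=> oU fS r; elim: r f fS => [|r IH] f fS; split => //.
- by move=> x Ux; exact: smooth_along_paths_continuous fS.
- by move=> x Ux; exact: smooth_along_paths_continuous fS.
move=> i; split; last exact/IH/smooth_along_paths_derive.
by move=> x Ux; exact: smooth_along_paths_derivable fS.
Qed.

End Boman.


(** * The chain rule along paths *)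

Section ChainRule.
Variables (R : realType) (n : nat).
Implicit Types (x v : 'rV[R]_n) (U : set 'rV[R]_n) (f : 'rV[R]_n -> R).

(** The increment is split into steps parallel to the axes, and the mean value
    theorem is applied on each of them. *)
Lemma mean_value_partial f x v :
  (forall y i, `|y - x| <= `|v| -> derivable f y (delta_mx 0 i)) ->
  exists2 xi : 'I_n -> 'rV[R]_n, forall i, `|xi i - x| <= `|v| &
    f (x + v) - f x = \sum_i 'D_(delta_mx 0 i) f (xi i) * v 0 i.
Proof.
move=> df; pose w k : 'rV[R]_n := \row_i (if (i < k)%N then v 0 i else 0).
have step (k : 'I_n) : exists xi, `|xi - x| <= `|v| /\
    f (x + w k.+1) - f (x + w k) = 'D_(delta_mx 0 k) f xi * v 0 k.
  have near_x (s : R) : `|s| <= `|v 0 k| ->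
      `|s *: delta_mx 0 k + (x + w k) - x| <= `|v|.
    move=> sv; rewrite [x + _]addrC addrA addrK; apply: row_norm_le => // j.
    rewrite !mxE eqxx/=; have [->|jk] := eqVneq j k.
      by rewrite ltnn mulr1 addr0 (le_trans sv)// row_entry_le.
    rewrite mulr0 add0r; case: ifP => _; first exact: row_entry_le.
    by rewrite normr0.
  have [|c cv] := @mean_value R (fun s => f (s *: delta_mx 0 k + (x + w k)))
      (fun s => 'D_(delta_mx 0 k) f (s *: delta_mx 0 k + (x + w k))) (v 0 k).
    move=> s sv; rewrite -derive1_line; apply: derivable_is_derive1.
    by apply/derivable_lineP/df/near_x.
  move=> E; exists (c *: delta_mx 0 k + (x + w k)); split; first exact: near_x.
  rewrite -E scale0r add0r; congr (f _ - _).
  apply/rowP => j; rewrite !mxE eqxx/= ltnS leq_eqVlt.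
  have [->|jk] := eqVneq j k; first by rewrite eqxx ltnn mulr1 addr0 addrC.
  by rewrite (negbTE (_ : j != k :> nat))//= mulr0 add0r.
have {step} [xi xiP] := choice step.
exists xi; first by move=> i; have [] := xiP i.
transitivity (\sum_(0 <= k < n) (f (x + w k.+1) - f (x + w k))).
  rewrite telescope_sumr//; congr (f _ - f _).
    by congr (_ + _); apply/rowP => i; rewrite mxE ltn_ord.
  by rewrite (_ : w 0%N = 0) ?addr0//; apply/rowP => i; rewrite !mxE.
by rewrite big_mkord; apply: eq_bigr => k _; have [] := xiP k.
Qed.

(** The difference quotient is the sum of the partial derivatives at intermediate
    points multiplied by the difference quotients of the coordinates; the
    intermediate points tend to gam t. *)
Lemma is_derive_path U f (gam : R -> 'rV[R]_n) (t : R) : open U ->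
  (forall x i, U x -> derivable f x (delta_mx 0 i)) ->
  (forall x i, U x -> {for x, continuous ('D_(delta_mx 0 i) f)}) ->
  smooth_path gam -> (forall t, U (gam t)) ->
  is_derive t 1 (fun t => f (gam t))
    (\sum_i 'D_(delta_mx 0 i) f (gam t) * derive1 (fun t => gam t 0 i) t).
Proof.
move=> oU df cf gamS gamU; have [r r0 rU] := open_closed_ball oU (gamU t).
have /nbhs_ballP[d /= d0 Hd] := smooth_path_near t gamS r0.
have bd (h : R) : `|h| < d -> ball t d (h + t).
  by move=> hd; rewrite /ball/= opprD addrCA subrr addr0 normrN.
have step (h : R) : exists xi : 'I_n -> 'rV[R]_n, `|h| < d ->
   (forall i, `|xi i - gam t| <= `|gam (h + t) - gam t|) /\
   f (gam (h + t)) - f (gam t) =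
     \sum_i 'D_(delta_mx 0 i) f (xi i) * (gam (h + t) - gam t) 0 i.
  have [hd|] := ltP `|h| d; last by exists (fun=> 0).
  have [|xi xir E] := @mean_value_partial f (gam t) (gam (h + t) - gam t).
    move=> y i yr; apply/df/rU/(le_trans yr); exact: Hd (bd _ hd).
  by exists xi => _; split => //; rewrite -E [gam t + _]addrC subrK.
have {step} [xi xiP] := choice step.
have c : h^-1 *: (((fun t => f (gam t)) \o shift t) (h *: (1 : R)) - f (gam t))
   @[h --> 0^'] -->
   \sum_i 'D_(delta_mx 0 i) f (gam t) * derive1 (fun t => gam t 0 i) t.
  apply: (@cvg_trans _ ((\sum_i 'D_(delta_mx 0 i) f (xi h i) *
      (h^-1 * (gam (h + t) 0 i - gam t 0 i))) @[h --> 0^'])).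
    apply: near_eq_cvg; near=> h.
    have hd : `|h| < d by near: h; exact: dnbhs0_lt.
    have [_ E] := xiP h hd.
    rewrite /= -[_ *: 1]/(h * 1) mulr1 E -[_ *: _]/(_ * _) mulr_sumr.
    by apply: eq_bigr => i _; rewrite !mxE mulrCA.
  apply: cvg_big => [|i _]; first exact: add_continuous.
  apply: cvgM.
    apply/cvgrPdist_lt => e e0.
    have [a a0 Ha] := (continuous_rowP _ _).1 (cf _ i (gamU t)) e e0.
    have a20 : 0 < a / 2 by rewrite divr_gt0.
    have /nbhs_ballP[b /= b0 Hb] := smooth_path_near t gamS a20.
    near=> h.
    have hd : `|h| < d by near: h; exact: dnbhs0_lt.
    have hb : `|h| < b by near: h; exact: dnbhs0_lt.
    apply: Ha; have [/(_ i) le_xi _] := xiP h hd; rewrite (le_lt_trans le_xi)//.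
    apply: (@le_lt_trans _ _ (a / 2)).
      by apply: Hb; rewrite /ball/= opprD addrCA subrr addr0 normrN.
    by rewrite ltr_pdivrMr// ltr_pMr// ltr1n.
  have := ex_derive (is_derive := smooth_is_derive t (gamS i)).
  move=> /cvg_ex[l cl]; rewrite derive1E /derive (cvg_lim _ cl)//.
  apply: cvg_trans cl; apply: near_eq_cvg; near=> h.
  by rewrite /= -[_ *: 1]/(h * 1) mulr1.
by apply: DeriveDef; [apply/cvg_ex; eexists; exact: c|exact/cvg_lim].
Unshelve. all: by end_near. Qed.

Lemma derivable_n_sum k m (F : 'I_m -> R -> R) : (forall i, derivable_n k (F i)) ->
  derivable_n k (fun u => \sum_i F i u).
Proof.
elim: m F => [|m IH] F DF.
  rewrite (_ : (fun u => _) = (fun=> 0)); first exact: derivable_n_cst.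
  by apply/funext => u; rewrite big_ord0.
rewrite (_ : (fun u => _) =
    (fun u => F ord0 u + \sum_(i < m) F (lift ord0 i) u)).
  by apply: derivable_nD; [exact: DF|apply: IH].
by apply/funext => u; rewrite big_ord_recl.
Qed.

Lemma smooth_on_path U f gam : open U -> smooth_on U f -> smooth_path gam ->
  (forall t, U (gam t)) -> smooth_curve (fun t => f (gam t)).
Proof.
move=> oU fS gamS gamU; apply/smooth_curveP => k.
elim: k f {fS}(fS k) => [//|k IH] f [_ fk].
exists (fun t => \sum_i 'D_(delta_mx 0 i) f (gam t) * derive1 (fun t => gam t 0 i) t).
split.
  move=> t; apply: (@is_derive_path U f gam t oU _ _ gamS gamU).
    by move=> x i Ux; have [d _] := fk i; exact: d.
  by move=> x i Ux; have [_] := fk i; case: (k) => [|?] [c _]; exact: (c x Ux).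
apply: derivable_n_sum => i; apply: derivable_nM.
  by apply: (IH ('D_(delta_mx 0 i) f)); have [] := fk i.
by move: k {IH fk}; apply/smooth_curveP/smooth_derive1.
Qed.

End ChainRule.

(** * Frolicher structures and reflexive differential structures *)

Section Frolicher.
Variables (R : realType) (X : Type).
Implicit Types (C : set (R -> X)) (F : set (X -> R)).

Lemma Phi_curves_nonempty C : Phi_curves C !=set0.
Proof. by exists (fun=> 0) => c _; exact: smooth_cst. Qed.

Lemma Phi_curves_comp C k (f : 'I_k -> X -> R) (G : 'rV[R]_k -> R) :
  (forall i, Phi_curves C (f i)) -> smooth_on setT G ->
  Phi_curves C (fun x => G (\row_i f i x)).
Proof.
move=> fC GS c Cc.
apply: (@smooth_on_path R k setT G (fun t => \row_i f i (c t)) openT GS) => // i.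
rewrite (_ : (fun t => _) = f i \o c); first exact: fC.
by apply/funext => t; rewrite mxE.
Qed.

(** The sets with open preimage under c form a topology that contains the
    generators, by continuity of the functions f o c. *)
Lemma Gamma_preimage_open F U (c : R -> X) : Gamma F c -> initial_open F U ->
  open (c @^-1` U).
Proof.
move=> Fc FU; apply: (FU [set A | open (c @^-1` A)]); split.
  split; rewrite /mkset.
  - by rewrite preimage_setT; exact: openT.
  - by move=> A B oA oB; rewrite preimage_setI; exact: openI.
  - by move=> S oS; rewrite preimage_bigcup; apply: bigcup_open => A /oS.
move=> A [f [V [Ff oV ->]]] /=; rewrite -comp_preimage.
apply: open_comp oV => x _; exact: smooth_continuous (Fc f Ff) x.
Qed.

Lemma Phi_curves_local C (f : X -> R) :
  Gamma (Phi_curves C) = C ->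
  (forall x, exists U g, [/\ initial_open (Phi_curves C) U, U x,
     Phi_curves C g & {in U, f =1 g}]) -> Phi_curves C f.
Proof.
move=> GC fl c Cc; apply: smooth_local => t.
have [U [g [oU Ut Cg fg]]] := fl (c t).
exists (g \o c); first exact: Cg.
have oc : open (c @^-1` U) by apply: Gamma_preimage_open oU; rewrite GC.
apply: filterS (open_nbhs_nbhs (conj oc Ut)) => u Uu.
by rewrite /= fg// inE.
Qed.

Lemma frolicher_differential_structure C F : Phi_curves C = F -> Gamma F = C ->
  differential_structure F.
Proof.
move=> <- GC; split; first exact: Phi_curves_nonempty.
  by move=> k f G _; exact: Phi_curves_comp.
by move=> f; exact: Phi_curves_local.
Qed.

Definition curve_parametrisation (c : R -> X) : parametrisation R X :=
  @Parametrisation R X 1 setT openT (fun u => c ((\val u) 0 0)).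

(** The function v |-> f (c (v_0)) is smooth along paths. *)
Lemma Pi_curve F c : Gamma F c -> Pi F (curve_parametrisation c).
Proof.
move=> Fc f Ff; exists (fun v : 'rV[R]_1 => f (c (v 0 0))); split => //.
apply: smooth_along_paths_smooth_on; first exact: openT.
move=> gam gamS _; exact: (smooth_comp (Fc f Ff) (gamS 0)).
Qed.

Lemma smooth_from_curve (f : X -> R) c :
  smooth_from (f \o par_fun (curve_parametrisation c)) -> smooth_curve (f \o c).
Proof.
move=> [g [gE gS]].
rewrite (_ : f \o c = fun t => g (\row_(i < 1) t)).
  apply: (smooth_on_path openT gS) => // i.
  rewrite (_ : (fun t => _) = (fun t => t)); first exact: smooth_id.
  by apply/funext => t; rewrite mxE.
apply/funext => t; have := gE (SigSub (mem_set (I : [set: 'rV[R]_1] (\row_(i < 1) t)))).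
by rewrite /= => ->; rewrite mxE.
Qed.

Lemma frolicher_reflexive C F : Phi_curves C = F -> Gamma F = C ->
  reflexive_structure F.
Proof.
move=> PC GF; apply/seteqP; split => [f fP|f Ff p]; last by apply.
rewrite -PC => c; rewrite -GF => Fc.
by apply: smooth_from_curve; apply: fP; exact: Pi_curve.
Qed.

(** The chain rule for functions that are only given on U. *)
Lemma smooth_from_path n (U : set 'rV[R]_n) (h : set_type U -> R)
    (gam : R -> set_type U) : open U -> smooth_from h ->
  smooth_path (fun t => \val (gam t)) -> smooth_curve (h \o gam).
Proof.
move=> oU [g [gE gS]] gamS.
rewrite (_ : h \o gam = fun t => g (\val (gam t))); last by apply/funext => t; rewrite gE.
by apply: (smooth_on_path oU gS gamS) => t; exact: set_mem (valP (gam t)).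
Qed.

(** Boman's theorem for functions that are only given on U. *)
Lemma smooth_from_paths n (U : set 'rV[R]_n) (h : set_type U -> R) : open U ->
  (forall gam : R -> set_type U, smooth_path (fun t => \val (gam t)) ->
     smooth_curve (h \o gam)) ->
  smooth_from h.
Proof.
move=> oU hS.
(* Any value is allowed outside of U. *)
pose g v := if pselect (U v) is left Uv then h (SigSub (mem_set Uv)) else 0.
have gE v (Uv : U v) : g v = h (SigSub (mem_set Uv)).
  by rewrite /g; case: pselect => // Uv'; rewrite (Prop_irrelevance Uv' Uv).
exists g; split.
  by move=> u; rewrite (gE _ (set_mem (valP u))); congr (h _); exact: val_inj.
apply: smooth_along_paths_smooth_on => // gam gamS gamU.
rewrite (_ : (fun t => _) = h \o (fun t => SigSub (mem_set (gamU t)))).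
  exact: hS.
by apply/funext => t; rewrite gE.
Qed.

(** For p in Pi F and a smooth path gam in its domain, p o gam is in Gamma F;
    so a function that is smooth along Gamma F is smooth along all the paths in
    the domain of p, and Boman's theorem applies. *)
Lemma reflexive_Phi_Gamma F : reflexive_structure F -> Phi_curves (Gamma F) = F.
Proof.
move=> Fr; apply/seteqP; split => [f fG|f Ff c]; last by apply.
rewrite -Fr => p Fp; apply: smooth_from_paths; first exact: par_open.
move=> gam gamS; suff: Gamma F (par_fun p \o gam) by exact: fG.
move=> g Fg; exact: (@smooth_from_path _ _ (g \o par_fun p) gam
  (@par_open _ _ p) (Fp g Fg) gamS).
Qed.

End Frolicher.

(** * Equality of functors *)

Section ConcreteFunctors.
Variables C D : category.

Lemma functor_eq (F G : functor C D) (eo : fobj F = fobj G) :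
  (forall a b (f : hom a b),
    eq_rect (fobj F) (fun o => hom (o a) (o b)) (fmap F f) (fobj G) eo =
    fmap G f) -> F = G.
Proof.
case: F G eo => [ob m m1 mM] [ob' m' m1' mM'] /= eo.
move: m' m1' mM'; case: ob' / eo => m' m1' mM' /= mm'.
have E : m = m'.
  apply: functional_extensionality_dep => a.
  apply: functional_extensionality_dep => b.
  by apply: functional_extensionality_dep => f; exact: mm'.
move: m1' mM' {mm'}; case: m' / E => m1' mM'.
by rewrite (Prop_irrelevance m1 m1') (Prop_irrelevance mM mM').
Qed.

Variables (U : obj D -> Type) (u : forall x y, hom x y -> U x -> U y).
Hypothesis u_inj : forall x y, injective (@u x y).

(** When the morphisms of D are functions between underlying sets, functors that
    agree on objects can be compared through underlying sets; the identification
    of the latter may then be taken to be the identity even though the objects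
    are only provably equal. *)
Lemma concrete_functor_eq (F G : functor C D)
    (eU : (fun a => U (fobj F a)) = (fun a => U (fobj G a))) :
  (forall a, fobj F a = fobj G a) ->
  (forall a b (f : hom a b),
    eq_rect (fun a => U (fobj F a)) (fun T => T a -> T b) (u (fmap F f))
      (fun a => U (fobj G a)) eU = u (fmap G f)) -> F = G.
Proof.
move=> eo' ef; have eo : fobj F = fobj G by exact/funext.
apply: (@functor_eq _ _ eo) => a b f; apply: u_inj; rewrite -ef.
rewrite (Prop_irrelevance eU (f_equal (fun o a => U (o a)) eo)).
by move: (fobj G) eo {eU ef eo'} => o eo; case: o / eo.
Qed.

End ConcreteFunctors.

(** * The isomorphism of categories *)

Section Isomorphism.
Variable R : realType.

Lemma Xi_wd : Xi_well_defined R.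
Proof.
move=> X; split.
  exact: frolicher_differential_structure (fs_PhiE X) (fs_GammaE X).
exact: frolicher_reflexive (fs_PhiE X) (fs_GammaE X).
Qed.

Definition frolicher_of_reflexive (Y : obj (RefDiffSp R)) : frolicher_space R :=
  FrolicherSpace (ds_nonempty (sval Y)) (reflexive_Phi_Gamma (svalP Y)) erefl.

Definition frolicher_of_reflexive_map (Y Z : obj (RefDiffSp R)) (h : hom Y Z) :
    @hom (FrolSp R) (frolicher_of_reflexive Y) (frolicher_of_reflexive Z) :=
  exist _ (sval h) (svalP h).

#[local] Obligation Tactic := idtac.

Program Definition frolicher_functor : functor (RefDiffSp R) (FrolSp R) :=
  @Functor (RefDiffSp R) (FrolSp R) frolicher_of_reflexive
    frolicher_of_reflexive_map _ _.
Next Obligation. by move=> Y; apply: eq_exist. Qed.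
Next Obligation. by move=> Y Z W g f; apply: eq_exist. Qed.

Lemma frolicher_space_eq (X : Type) (ne : inhabited X) (C C' : set (R -> X))
    (F : set (X -> R)) (P : Phi_curves C = F) (P' : Phi_curves C' = F)
    (G : Gamma F = C) (G' : Gamma F = C') :
  FrolicherSpace ne P G = FrolicherSpace ne P' G'.
Proof.
have E : C = C' by rewrite -G.
move: P' G'; case: C' / E => P' G'.
by rewrite (Prop_irrelevance P P') (Prop_irrelevance G G').
Qed.

Lemma frolicher_functorK :
  comp_functor frolicher_functor (Xi Xi_wd) = id_functor (FrolSp R).
Proof.
pose u (X Y : obj (FrolSp R)) (h : hom X Y) := sval h.
have u_inj X Y : injective (@u X Y).
  by move=> [f Sf] [g Sg] /= fg; exact: eq_exist.
refine (@concrete_functor_eq (FrolSp R) (FrolSp R) (@fs_carrier R) u u_inj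
  (comp_functor frolicher_functor (Xi Xi_wd)) (id_functor (FrolSp R)) erefl _ _) => //.
by case=> X ne C F P G; exact: frolicher_space_eq.
Qed.

Lemma Xi_frolicherK :
  comp_functor (Xi Xi_wd) frolicher_functor = id_functor (RefDiffSp R).
Proof.
pose u (X Y : obj (RefDiffSp R)) (h : hom X Y) := sval h.
have u_inj X Y : injective (@u X Y).
  by move=> [f Sf] [g Sg] /= fg; exact: eq_exist.
refine (@concrete_functor_eq (RefDiffSp R) (RefDiffSp R)
  (fun Y : obj (RefDiffSp R) => ds_carrier (sval Y)) u u_inj
  (comp_functor (Xi Xi_wd) frolicher_functor) (id_functor (RefDiffSp R)) erefl _ _) => //.
case=> [[X ne F S] Fr]; apply: eq_exist => /=.
by congr DifferentialSpace; exact: Prop_irrelevance.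
Qed.

End Isomorphism.

Theorem corollary2p58 (R : realType) :
  exists wd : Xi_well_defined R, is_category_iso (Xi wd).
Proof.
exists (@Xi_wd R), (frolicher_functor R); split.
  exact: frolicher_functorK.
exact: Xi_frolicherK.
Qed.
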